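(* Let $S\subset\mathbb{R}^2$ be a measurable set such that for some $B>0$ and some $E\ge B$ there is a constant $C>0$ with $$\lVert f\rVert_{L^2(\mathbb{R}^2)}^2\le C\lVert f\rVert_{L^2(S)}^2\quad\text{for all } f\in\operatorname{Ran}\mathbf{1}_{(-\infty,E]}(H_B).$$ Then $S$ is thick.
   Context: For $B>0$ the Landau operator is $H_B=\tilde\partial_1^2+\tilde\partial_2^2$ with $\tilde\partial_1=i\partial_1-\frac B2x_2$, $\tilde\partial_2=i\partial_2+\frac B2x_1$, a self-adjoint operator in $L^2(\mathbb{R}^2)$ with operator core $C_0^\infty(\mathbb{R}^2)$ and spectrum $\{B,3B,5B,\dots\}$. $\mathbf{1}_{(-\infty,E]}(H_B)$ is the spectral projector onto energies up to $E$, and $\operatorname{Ran}$ denotes the range. A measurable set $S\subseteq\mathbb{R}^2$ is thick if there are $\ell=(\ell_1,\ell_2)\in(0,\infty)^2$ and $\rho\in(0,1]$ such that $\operatorname{Vol}(S\cap Q)\ge\rho\operatorname{Vol}(Q)$ for every rectangle $Q$ with side lengths $(\ell_1,\ell_2)$ parallel to the coordinate axes ($\operatorname{Vol}$ is Lebesgue measure). *)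

(* Defs.v *)
From HB Require Import structures.
From mathcomp Require Import all_boot all_order all_algebra.
From mathcomp Require Import all_classical all_reals all_analysis.
From mathcomp.real_closed Require Import complex.

Set Implicit Arguments.
Unset Strict Implicit.
Unset Printing Implicit Defensive.

Import Order.TTheory GRing.Theory Num.Theory.
Import numFieldNormedType.Exports.

Local Open Scope classical_set_scope.
Local Open Scope complex_scope.
Local Open Scope ring_scope.

Section Defs.
Context {R : realType}.

Definition borel_area :
    {measure set (measurableTypeR R * measurableTypeR R)%type -> \bar R} :=
  ((@lebesgue_measure R) \x (@lebesgue_measure R))%E.

(* R^2 with its Lebesgue (not only Borel) sigma-algebra: the sets that are
   Caratheodory-measurable for the outer measure induced by borel_area. *)
Definition plane : Type := caratheodory_type (borel_area^*)%mu.

Definition area : {measure set plane -> \bar R} :=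
  @completed_measure_extension _ _ R borel_area.

Definition rectangle (a l : R * R) : set plane :=
  `[a.1, a.1 + l.1] `*` `[a.2, a.2 + l.2].

Definition thick (S : set plane) : Prop :=
  exists (l : R * R) (rho : R),
    [/\ 0 < l.1, 0 < l.2, 0 < rho <= 1 &
      forall a : R * R,
        (rho%:E * area (rectangle a l) <= area (S `&` rectangle a l))%E].

Local Notation cfun := (R * R -> R[i]).
Local Notation re := (@complex.Re R).
Local Notation im := (@complex.Im R).

Definition sqmod (z : R[i]) : R := re z ^+ 2 + im z ^+ 2.

Definition sqnorm (S : set plane) (f : cfun) : \bar R :=
  (\int[area]_(x in S) (sqmod (f x))%:E)%E.

(* Elements of L^2(R^2; C) are represented by functions, and equality in L^2
   is equality almost everywhere. *)
Definition L2 (f : cfun) : Prop :=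
  (re \o f : plane -> R) \in Lfun area 2%:E /\
  (im \o f : plane -> R) \in Lfun area 2%:E.

Definition aeeq (f g : cfun) : Prop :=
  \forall x \ae area, f x = g x.

(* Conjugate-linear in the first argument. *)
Definition inner (f g : cfun) : R[i] :=
  (\int[area]_x re (conjc (f x) * g x))%R +i*
  (\int[area]_x im (conjc (f x) * g x))%R.

Definition cpartial (v : R * R) (f : cfun) : cfun := fun x =>
  ('D_v (re \o f : R * R -> R) x) +i*
  ('D_v (im \o f : R * R -> R) x).

Definition smooth (u : R * R -> R) : Prop :=
  forall (vs : seq (R * R)) (x : R * R),
    differentiable (foldr (fun v w => 'D_v w) u vs) x.

Definition test_function (f : cfun) : Prop :=
  [/\ smooth (re \o f), smooth (im \o f) &
      compact (closure [set x : R * R | f x != 0])].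

Definition magnetic1 (B : R) (f : cfun) : cfun := fun x =>
  'i%C * cpartial (1, 0) f x - (B / 2 * x.2)%:C * f x.

Definition magnetic2 (B : R) (f : cfun) : cfun := fun x =>
  'i%C * cpartial (0, 1) f x + (B / 2 * x.1)%:C * f x.

Definition landau_expr (B : R) (f : cfun) : cfun := fun x =>
  magnetic1 B (magnetic1 B f) x + magnetic2 B (magnetic2 B f) x.

(* Unbounded operators are given by their graphs.  As the test functions are
   an operator core, the Landau operator is the closure in L^2 x L^2 of the
   differential expression acting on test functions. *)
Definition landau (B : R) (f g : cfun) : Prop :=
  [/\ L2 f, L2 g &
    exists phi : nat -> cfun,
      [/\ forall n, test_function (phi n),
          sqnorm setT (fun x => phi n x - f x) @[n --> \oo] --> 0%E &
          sqnorm setT (fun x => landau_expr B (phi n) x - g x)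
            @[n --> \oo] --> 0%E]].

Definition orthogonal_projection (p : cfun -> cfun) : Prop :=
  [/\ forall f, L2 f -> L2 (p f),
      forall f g, L2 f -> L2 g -> aeeq f g -> aeeq (p f) (p g),
      forall (c : R[i]) f g, L2 f -> L2 g ->
        aeeq (p (fun x => c * f x + g x)) (fun x => c * p f x + p g x),
      forall f, L2 f -> aeeq (p (p f)) (p f) &
      forall f g, L2 f -> L2 g -> inner (p f) g = inner f (p g)].

(* P is the projection-valued measure of the operator with graph H, that is,
   H is the integral of t with respect to P.  The measure m below is
   A |-> <f, P A f> = |P A f|^2, and f is in the domain of H iff t^2 is
   m-integrable, in which case <f, H f> is the integral of t; by polarization
   this determines H. *)
Definition spectral_measure (H : cfun -> cfun -> Prop)
    (P : set (measurableTypeR R) -> cfun -> cfun) : Prop :=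
  [/\ forall A, measurable A -> orthogonal_projection (P A),
      forall f, L2 f -> aeeq (P setT f) f,
      forall A A' f, measurable A -> measurable A' -> L2 f ->
        aeeq (P (A `&` A') f) (P A (P A' f)) &
      forall f, L2 f ->
        exists m : {measure set (measurableTypeR R) -> \bar R},
          [/\ forall A, measurable A -> m A = sqnorm setT (P A f),
              (exists g, H f g) <-> (\int[m]_t (t ^+ 2)%:E < +oo)%E &
              forall g, H f g -> inner f g = (\int[m]_t t)%R%:C]].

(* The range of 1_A(H), for H self-adjoint: the range of P A, where P is the
   spectral measure of H, which is unique up to equality almost everywhere. *)
Definition spectral_range (H : cfun -> cfun -> Prop)
    (A : set (measurableTypeR R)) (f : cfun) : Prop :=
  L2 f /\
  forall P, spectral_measure H P -> exists2 g, L2 g & aeeq f (P A g).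

End Defs.

Arguments plane R : clear implicits.

(* Main.v *)
Require Import Defs.
From HB Require Import structures.
From mathcomp Require Import all_boot all_order all_algebra.
From mathcomp Require Import all_classical all_reals all_analysis.
From mathcomp.real_closed Require Import complex.
From mathcomp Require Import measurable_realfun ring lra.

Set Implicit Arguments.
Unset Strict Implicit.
Unset Printing Implicit Defensive.

Import Order.TTheory GRing.Theory Num.Theory.
Import numFieldNormedType.Exports.

Local Open Scope classical_set_scope.
Local Open Scope ring_scope.

(** For every point [a], the function [exp (- B |x - a|^2 / 4)] times a phase
    linear in [x] is in the lowest Landau level, and its squared modulus is a
    Gaussian centred at [a].  The hypothesis then says that a fixed part of the
    mass of this Gaussian lies in [S].  As the Gaussian is at most 1 and its
    mass outside a large square centred at [a] is small, uniformly in [a], the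
    set [S] fills a fixed proportion of every square of that size.

    To see that such a function [f] is in the range of the spectral projector,
    only the weak equation [<f, H h> = B <f, h>], for [h] in the domain of [H],
    is used; it follows from integration by parts against test functions, so
    that [f] need not be approximated by test functions.  Let [h = P_A f] with
    [A] a closed bounded interval in [(E, +oo)].  Then [h] is in the domain and
    [P_A H h = H h], whence the spectral mass [m] of [h], which is carried by
    [A], satisfies [\int t dm = <h, H h> = <f, H h> = B <f, h> = B |h|^2]; since
    [t > B] on [A], [h = 0]. *)

(** * Borel sets and integrals on the plane *)

Section PlaneMeasure.
Context {R : realType}.

Local Notation borel2 := (measurableTypeR R * measurableTypeR R)%type.

(** An open set is the union of the open boxes with rational corners that it contains, and there are
    only countably many such boxes. *)
Lemma open_measurable_prod (U : set (R * R)) :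
  open U -> measurable (U : set borel2).
Proof.
move=> oU.
pose box (q : (rat * rat) * (rat * rat)) : set (R * R) :=
  `]ratr q.1.1, ratr q.1.2[ `*` `]ratr q.2.1, ratr q.2.2[.
pose F q := if `[< box q `<=` U >] then box q else set0.
rewrite (_ : U = \bigcup_q F q).
  apply: countable_bigcupT_measurable => // q; rewrite /F.
  by case: ifPn => // _; apply: measurableX; exact: measurable_itv.
apply/seteqP; split => [[x y] Uxy|p [q _]]; last first.
  by rewrite /F; case: asboolP => // /[apply].
have /nbhs_ballP[e /= e0 exy] : nbhs (x, y) U by exact: open_nbhs_nbhs.
have rat_near (z : R) : exists r s : rat,
    [/\ z - e < ratr r, ratr r < z, z < ratr s & ratr s < z + e].
  have [r] := @rat_in_itvoo R (z - e) z ltac:(by rewrite ltrBlDr ltrDl).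
  have [s] := @rat_in_itvoo R z (z + e) ltac:(by rewrite ltrDl).
  by rewrite !in_itv/= => /andP[? ?] /andP[? ?]; exists r, s.
have [r1 [s1 [xr1 r1x xs1 s1x]]] := rat_near x.
have [r2 [s2 [yr2 r2y ys2 s2y]]] := rat_near y.
have boxU : box ((r1, s1), (r2, s2)) `<=` U.
  move=> [a b] [/=]; rewrite !in_itv/= => /andP[ra sa] /andP[rb sb].
  by apply: exy; split; rewrite /ball/= ltr_norml; apply/andP; split; lra.
exists ((r1, s1), (r2, s2)) => //; rewrite /F asboolT//.
by split => /=; rewrite in_itv/=; apply/andP.
Qed.

Lemma continuous_measurable_prod (u : R * R -> R) :
  continuous u -> measurable_fun [set: borel2] (u : borel2 -> R).
Proof.
move=> /continuousP cu.
apply: (measurability _ (RGenOpens.measurableE R)).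
move=> _ [_ [a [b ->] <-]]; rewrite setTI; apply: open_measurable_prod.
apply: cu; exact: interval_open.
Qed.

Lemma borel_measurable_plane (A : set borel2) :
  measurable A -> measurable (A : set (plane R)).
Proof. exact: caratheodory_measurable_mu_ext. Qed.

Lemma areaE (A : set borel2) : measurable A -> area A = borel_area A.
Proof. exact: measurable_mu_extE. Qed.

Lemma measurable_fun_plane d (T : measurableType d) (f : borel2 -> T) :
  measurable_fun [set: borel2] f -> measurable_fun [set: plane R] (f : plane R -> T).
Proof.
by move=> mf _ Y mY; rewrite setTI; apply: borel_measurable_plane;
  rewrite -[X in measurable X]setTI; exact: mf.
Qed.

Let toB : plane R -> borel2 := id.

(** The push-forward of [area] along the identity [toB] agrees with [borel_area] on Borel sets.
    Integrals of Borel functions can thus be computed for the product measure, to which Tonelli and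
    Fubini apply. *)
Lemma ge0_integral_area (f : borel2 -> \bar R) :
  measurable_fun [set: borel2] f -> (forall x, 0 <= f x)%E ->
  (\int[area]_x f x = \int[borel_area]_x f x)%E.
Proof.
move=> mf f0.
have mtoB : measurable_fun [set: plane R] toB.
  by apply: measurable_fun_plane; exact: measurable_id.
have := @ge0_integral_pushforward _ _ _ _ R _ mtoB area setT f measurableT mf
  (fun y _ => f0 y).
rewrite preimage_setT => <-; apply: eq_measure_integral => A mA _.
exact: areaE.
Qed.

Lemma area_rectangle (a l : R * R) : 0 < l.1 -> 0 < l.2 ->
  area (rectangle a l) = (l.1 * l.2)%:E.
Proof.
move=> l1 l2; rewrite areaE; last by apply: measurableX; exact: measurable_itv.
have len (x t : R) : 0 < t -> lebesgue_measure (`[x, x + t]%classic : set R) = t%:E.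
  by move=> t0; rewrite lebesgue_measure_itv/= lte_fin ltrDl t0 -EFinB addrC addKr.
rewrite [LHS]product_measure1E; try exact: measurable_itv.
transitivity (l.1%:E * l.2%:E)%E => //.
by congr (_ * _)%E; exact: len.
Qed.

Lemma measurable_rectangle (a l : R * R) :
  measurable (rectangle a l : set (plane R)).
Proof.
by apply: borel_measurable_plane; apply: measurableX; exact: measurable_itv.
Qed.

End PlaneMeasure.

(** * The inner product of L2 *)

Section L2Theory.
Context {R : realType}.

Local Notation cfun := (R * R -> R[i]).
Local Notation re := (@complex.Re R).
Local Notation im := (@complex.Im R).
Local Notation rL2 u := ((u : plane R -> R) \in Lfun (@area R) 2%:E).
Local Notation ip u v := (\int[@area R]_x (u x * v x)).

Lemma area_aeS (P Q : set (R * R)) : P `<=` Q ->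
  (\forall x \ae area, P x) -> \forall x \ae area, Q x.
Proof. by move=> PQ; exact: (@filterS _ _ (ae_filter_ringOfSetsType area)). Qed.

Lemma area_aeS2 (P Q S : set (R * R)) : (forall x, P x -> Q x -> S x) ->
  (\forall x \ae area, P x) -> (\forall x \ae area, Q x) ->
  \forall x \ae area, S x.
Proof. by move=> PQ; exact: (@filterS2 _ _ (ae_filter_ringOfSetsType area)). Qed.

Lemma Lfun2P (u : plane R -> R) : measurable_fun setT u ->
  (\int[area]_x (u x ^+ 2)%:E < +oo)%E -> rL2 u.
Proof.
move=> mu fu; rewrite inE; apply/andP; split; rewrite inE//=.
rewrite /finite_norm unlock /Lnorm poweR_lty//.
rewrite (eq_integral (fun x => (u x ^+ 2)%:E))// => x _ /=.
by congr (_%:E); rewrite -[RHS]ger0_norm ?sqr_ge0// normrX;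
  exact: powR_mulrn.
Qed.

Lemma rL2_measurable (u : plane R -> R) : rL2 u -> measurable_fun setT u.
Proof. by rewrite inE => /andP[/[!inE]]. Qed.

Lemma rL2_lin a (u v : plane R -> R) : rL2 u -> rL2 v ->
  rL2 (fun x => a * u x + v x).
Proof.
move=> uL vL; have := Lfun_scale a _ uL => /(_ ltac:(by rewrite ler1n)) auL.
rewrite (_ : (fun x => _) = (a \o* u) + v); first by rewrite rpredD// lee1n.
by apply/funext => x /=; rewrite mulrC.
Qed.

Lemma ip_integrable (u v : plane R -> R) : rL2 u -> rL2 v ->
  area.-integrable setT (fun x => (u x * v x)%:E).
Proof. by move=> uL vL; apply/Lfun1_integrable; exact: Lfun2_mul_Lfun1. Qed.

Lemma ipC (u v : plane R -> R) : ip u v = ip v u.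
Proof. by apply: eq_Rintegral => x _; rewrite mulrC. Qed.

Lemma ip_linr a (u v w : plane R -> R) : rL2 u -> rL2 v -> rL2 w ->
  ip u (fun x => a * v x + w x) = a * ip u v + ip u w.
Proof.
move=> uL vL wL; under eq_Rintegral do rewrite mulrDr mulrCA.
rewrite RintegralD//; [|exact: (integrableZl measurableT a (ip_integrable uL vL))|
  exact: (ip_integrable uL wL)].
by rewrite RintegralZl//; exact: ip_integrable.
Qed.

Lemma L2_lin (c : R[i]) (f g : cfun) : L2 f -> L2 g ->
  L2 (fun x => c * f x + g x).
Proof.
move=> [fr fi] [gr gi]; split.
  rewrite (_ : _ \o _ = fun x => re c * re (f x) +
      (- im c * im (f x) + re (g x))); first by do 2 apply: rL2_lin => //.
  by apply/funext => x /=; case: c (f x) (g x) => ? ? [? ?] [? ?] /=; ring.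
rewrite (_ : _ \o _ = fun x => re c * im (f x) +
    (im c * re (f x) + im (g x))); first by do 2 apply: rL2_lin => //.
by apply/funext => x /=; case: c (f x) (g x) => ? ? [? ?] [? ?] /=; ring.
Qed.

Lemma L2_eq (f g : cfun) : f =1 g -> L2 f -> L2 g.
Proof. by move=> /funext ->. Qed.

Lemma L2_0 : L2 (fun=> 0 : R[i]).
Proof.
have L0 : rL2 (fun=> 0).
  apply: Lfun2P; first exact: measurable_cst.
  by rewrite integral0_eq ?ltry// => x _; rewrite expr0n.
by split; exact: L0.
Qed.

Lemma L2Z (c : R[i]) (f : cfun) : L2 f -> L2 (fun x => c * f x).
Proof.
by move=> fL; apply: L2_eq (L2_lin c fL L2_0) => x; rewrite addr0.
Qed.

Lemma L2D (f g : cfun) : L2 f -> L2 g -> L2 (fun x => f x + g x).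
Proof. by move=> fL gL; apply: L2_eq (L2_lin 1 fL gL) => x; rewrite mul1r. Qed.

Lemma L2B (f g : cfun) : L2 f -> L2 g -> L2 (fun x => f x - g x).
Proof.
move=> fL gL; apply: L2_eq (L2_lin (- 1) gL fL) => x.
by rewrite mulN1r addrC.
Qed.

Lemma innerE (f g : cfun) : L2 f -> L2 g -> inner f g =
  ((ip (re \o f) (re \o g) + ip (im \o f) (im \o g)) +i*
   (ip (re \o f) (im \o g) - ip (im \o f) (re \o g)))%C.
Proof.
move=> [fr fi] [gr gi]; rewrite /inner -RintegralD//; try exact: ip_integrable.
rewrite -RintegralB//; try exact: ip_integrable.
by congr (_ +i* _)%C; apply: eq_Rintegral => x _ /=;
  case: (f x) (g x) => ? ? [? ?] /=; ring.
Qed.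

Lemma inner_linr (c : R[i]) (f g h : cfun) : L2 f -> L2 g -> L2 h ->
  inner f (fun x => c * g x + h x) = c * inner f g + inner f h.
Proof.
move=> fL gL hL; rewrite !innerE//; last exact: L2_lin.
case: c => a b.
have eR : re \o (fun x => ((a +i* b)%C * g x + h x)%R) =
    fun x => a * re (g x) + (- b * im (g x) + re (h x)).
  by apply/funext => x /=; case: (g x) (h x) => ? ? [? ?] /=; ring.
have eI : im \o (fun x => ((a +i* b)%C * g x + h x)%R) =
    fun x => a * im (g x) + (b * re (g x) + im (h x)).
  by apply/funext => x /=; case: (g x) (h x) => ? ? [? ?] /=; ring.
case: fL gL hL => [fr fi] [gr gi] [hr hi].
have rL (u : plane R -> R) : rL2 u ->
  [/\ ip u (re \o (fun x => ((a +i* b)%C * g x + h x)%R)) =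
    a * ip u (re \o g) + (- b * ip u (im \o g) + ip u (re \o h)) &
   ip u (im \o (fun x => ((a +i* b)%C * g x + h x)%R)) =
    a * ip u (im \o g) + (b * ip u (re \o g) + ip u (im \o h))].
  by move=> uL; rewrite eR eI; split; rewrite !ip_linr//; exact: rL2_lin.
have [-> ->] := rL _ fr; have [-> ->] := rL _ fi.
by apply/eqP; rewrite eq_complex /=; apply/andP; split; apply/eqP; ring.
Qed.

Lemma innerC (f g : cfun) : L2 f -> L2 g -> inner g f = conjc (inner f g).
Proof.
move=> fL gL; rewrite !innerE// (ipC (re \o g) (re \o f)).
rewrite (ipC (im \o g) (im \o f)) (ipC (re \o g) (im \o f)).
by rewrite (ipC (im \o g) (re \o f)); congr (_ +i* _)%C; rewrite opprB.
Qed.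

Lemma inner_linl (c : R[i]) (f g h : cfun) : L2 f -> L2 g -> L2 h ->
  inner (fun x => c * g x + h x) f = conjc c * inner g f + inner h f.
Proof.
move=> fL gL hL; rewrite innerC//; last exact: L2_lin.
rewrite inner_linr// (innerC fL gL) (innerC fL hL).
case: c (inner f g) (inner f h) => ? ? [? ?] [? ?].
by apply/eqP; rewrite eq_complex/=; apply/andP; split; apply/eqP; ring.
Qed.

Lemma innerDr (f g h : cfun) : L2 f -> L2 g -> L2 h ->
  inner f (fun x => g x + h x) = inner f g + inner f h.
Proof.
move=> fL gL hL; have := inner_linr 1 fL gL hL.
by rewrite mul1r => <-; congr inner; apply/funext => x; rewrite mul1r.
Qed.

Lemma inner0r (f : cfun) : inner f (fun=> 0) = 0.
Proof.
rewrite /inner (_ : (fun x => re _) = cst 0); last first.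
  by apply/funext => x; rewrite mulr0.
rewrite (_ : (fun x => im _) = cst 0); last first.
  by apply/funext => x; rewrite mulr0.
by rewrite Rintegral_cst// mul0r.
Qed.

Lemma innerZr (c : R[i]) (f g : cfun) : L2 f -> L2 g ->
  inner f (fun x => c * g x) = c * inner f g.
Proof.
move=> fL gL; have := inner_linr c fL gL L2_0; rewrite inner0r addr0 => <-.
by congr inner; apply/funext => x; rewrite addr0.
Qed.

Lemma innerBr (f g h : cfun) : L2 f -> L2 g -> L2 h ->
  inner f (fun x => g x - h x) = inner f g - inner f h.
Proof.
move=> fL gL hL; have := inner_linr (-1) fL hL gL.
rewrite mulN1r addrC => <-; congr inner; apply/funext => x.
by rewrite mulN1r addrC.
Qed.

Lemma measurable_sqmod (f : cfun) : L2 f ->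
  measurable_fun [set: plane R] (fun x => (sqmod (f x))%:E).
Proof.
move=> [/rL2_measurable mr /rL2_measurable mi]; apply/measurable_EFinP.
by apply: measurable_funD; exact: measurable_funX.
Qed.

Lemma sqmod_ge0 (z : R[i]) : 0 <= sqmod z.
Proof. by rewrite addr_ge0// sqr_ge0. Qed.

Lemma inner_ff (f : cfun) : L2 f -> inner f f = (fine (sqnorm setT f))%:C%C.
Proof.
move=> fL; rewrite innerE// [ip (im \o f) (re \o f)]ipC subrr.
case: fL => fr fi; rewrite -RintegralD//; exact: ip_integrable.
Qed.

(** The squares of the real and imaginary parts are each dominated by [sqmod], so a single integral
    decides square integrability. *)
Lemma L2P (f : cfun) : L2 f <->
  [/\ measurable_fun [set: plane R] (re \o f : plane R -> R),
    measurable_fun [set: plane R] (im \o f : plane R -> R) &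
    (sqnorm setT f < +oo)%E].
Proof.
split=> [fL|[mr mi fin]].
  have [fr fi] := fL; split; try exact: rL2_measurable.
  exact: (integrable_lty measurableT
    (integrableD measurableT (ip_integrable fr fr) (ip_integrable fi fi))).
have mS : measurable_fun [set: plane R] (fun x => (sqmod (f x))%:E).
  by apply/measurable_EFinP; apply: measurable_funD; exact: measurable_funX.
have le_fin (u : plane R -> R) : measurable_fun setT u ->
    (forall x, u x ^+ 2 <= sqmod (f x)) -> rL2 u.
  move=> mu uf; apply: (Lfun2P mu); apply: le_lt_trans fin.
  apply: (ge0_le_integral area measurableT) => [x _| | |x _].
  - by rewrite lee_fin sqr_ge0.
  - by apply/measurable_EFinP; exact: measurable_funX.
  - exact: mS.
  - by rewrite lee_fin.
by split; [apply: (le_fin _ mr)|apply: (le_fin _ mi)] => x;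
  rewrite /sqmod /= ?lerDl ?lerDr sqr_ge0.
Qed.

Lemma sqnorm_fin_num (f : cfun) : L2 f -> sqnorm setT f \is a fin_num.
Proof.
move=> /L2P[_ _ fin]; rewrite ge0_fin_numE//; apply: integral_ge0 => x _.
by rewrite lee_fin sqmod_ge0.
Qed.

Lemma sqnorm_eq0 (f : cfun) : L2 f -> sqnorm setT f = 0%E ->
  aeeq f (fun=> 0).
Proof.
move=> fL f0.
have f0' : (\int[area]_x `|(sqmod (f x))%:E| = 0)%E.
  rewrite -[RHS]f0; apply: eq_integral => x _.
  by rewrite gee0_abs// lee_fin sqmod_ge0.
have := (ae_eq_integral_abs area measurableT (measurable_sqmod fL)).1 f0'.
apply: filterS => x /(_ I) [] /eqP; rewrite paddr_eq0 ?sqr_ge0// !sqrf_eq0.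
by case: (f x) => a b /= /andP[/eqP -> /eqP ->].
Qed.

Lemma sqnorm_aeeq (f g : cfun) : L2 f -> L2 g -> aeeq f g ->
  sqnorm setT f = sqnorm setT g.
Proof.
move=> fL gL fg.
apply: (ae_eq_integral _ _ measurableT (measurable_sqmod fL) (measurable_sqmod gL)).
by apply: area_aeS fg => x ->.
Qed.

Lemma aeeq_sym (f g : cfun) : aeeq f g -> aeeq g f.
Proof. by apply: area_aeS => x ->. Qed.

Lemma aeeq_trans (f g h : cfun) : aeeq f g -> aeeq g h -> aeeq f h.
Proof. by apply: area_aeS2 => x -> ->. Qed.

Lemma inner_aeeqr (f g h : cfun) : L2 f -> L2 g -> L2 h -> aeeq g h ->
  inner f g = inner f h.
Proof.
move=> fL gL hL gh.
have ip_ae (u v w : plane R -> R) : rL2 u -> rL2 v -> rL2 w ->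
    (\forall x \ae area, v x = w x) -> ip u v = ip u w.
  move=> uL vL wL vw; congr fine.
  apply: (ae_eq_integral _ _ measurableT
    (measurable_int _ (ip_integrable uL vL))
    (measurable_int _ (ip_integrable uL wL))).
  by apply: area_aeS vw => x ->.
rewrite !innerE//; case: fL gL hL => [fr fi] [gr gi] [hr hi].
have ghr : \forall x \ae area, (re \o g) x = (re \o h) x.
  by apply: area_aeS gh => x /= ->.
have ghi : \forall x \ae area, (im \o g) x = (im \o h) x.
  by apply: area_aeS gh => x /= ->.
by rewrite (ip_ae _ _ _ fr gr hr ghr) (ip_ae _ _ _ fi gr hr ghr)
  (ip_ae _ _ _ fr gi hi ghi) (ip_ae _ _ _ fi gi hi ghi).
Qed.

Lemma inner_aeeql (f g h : cfun) : L2 f -> L2 g -> L2 h -> aeeq g h ->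
  inner g f = inner h f.
Proof.
by move=> fL gL hL gh; rewrite innerC// (innerC fL hL) (inner_aeeqr fL gL hL gh).
Qed.

Lemma conjcM_sqmod (z : R[i]) : conjc z * z = (sqmod z)%:C%C.
Proof.
by case: z => a b; apply/eqP; rewrite eq_complex /sqmod /=; apply/andP; split;
  apply/eqP; ring.
Qed.

Lemma sqnorm_lin (c : R[i]) (f g : cfun) : L2 f -> L2 g ->
  sqnorm setT (fun x => c * f x + g x) =
  (sqmod c * fine (sqnorm setT f) + 2 * re (c * inner g f) +
    fine (sqnorm setT g))%:E.
Proof.
move=> fL gL; have hL := L2_lin c fL gL.
rewrite -(fineK (sqnorm_fin_num hL)); congr (_%:E).
have : inner (fun x => c * f x + g x) (fun x => c * f x + g x) =
    (sqmod c)%:C%C * inner f f + (c * inner g f + conjc (c * inner g f))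
    + inner g g.
  rewrite inner_linr// !inner_linl// (innerC gL fL) -conjcM_sqmod.
  case: c {hL} (inner f f) (inner g f) (inner g g) => ? ? [? ?] [? ?] [? ?].
  by apply/eqP; rewrite eq_complex/=; apply/andP; split; apply/eqP; ring.
rewrite !inner_ff//; case: (c * inner g f) => a b /(congr1 re) /= ->.
by ring.
Qed.

(** Cauchy-Schwarz with [1 + |f|^2] in place of [|f|^2], so that [t = 1 / (1 + |f|^2)] makes sense
    even for [f = 0]. It follows by expanding [0 <= |w - t <f, w> f|^2]. *)
Lemma sqmod_inner_le (f w : cfun) : L2 f -> L2 w ->
  sqmod (inner f w) <= (1 + fine (sqnorm setT f)) * fine (sqnorm setT w).
Proof.
move=> fL wL; set F := fine _; set W := fine _.
have F0 : 0 <= F by rewrite fine_ge0// integral_ge0// => x _; rewrite lee_fin sqmod_ge0.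
pose t := (1 + F)^-1; have tF : t * (1 + F) = 1 by rewrite mulVf; lra.
have t0 : 0 < t by rewrite invr_gt0; lra.
have hL := L2_lin (- (t%:C%C * inner f w)) fL wL.
have : (0 <= sqnorm setT (fun x => (- (t%:C%C * inner f w)) * f x + w x)%R)%E.
  by apply: integral_ge0 => x _; rewrite lee_fin sqmod_ge0.
rewrite sqnorm_lin// (innerC fL wL) -/F -/W lee_fin.
case: (inner f w) => a b; rewrite /sqmod /= => h.
have h' : 0 <= W - t * (a ^+ 2 + b ^+ 2) * (2 - t * F).
  by apply: le_trans h _; rewrite le_eqVlt; apply/orP; left; apply/eqP; ring.
have -> : a ^+ 2 + b ^+ 2 = (1 + F) * (t * (a ^+ 2 + b ^+ 2)).
  by rewrite mulrA [_ * t]mulrC tF mul1r.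
rewrite ler_wpM2l; [done|lra|].
have q0 : 0 <= t * (a ^+ 2 + b ^+ 2) by rewrite mulr_ge0 ?addr_ge0 ?sqr_ge0 ?ltW.
by nra.
Qed.

(** Continuity of [<f, .>], in the form that carries an identity from test functions over to the
    closure of an operator. *)
Lemma inner_sqnorm_cvg0 (c : R[i]) (f : cfun) (w : nat -> cfun) :
  L2 f -> (forall n, L2 (w n)) -> (forall n, inner f (w n) = c) ->
  sqnorm setT (w n) @[n --> \oo] --> 0%E -> c = 0.
Proof.
move=> fL wL fw w0.
suff : sqmod c <= 0.
  rewrite le_eqVlt ltNge sqmod_ge0 orbF paddr_eq0 ?sqr_ge0// !sqrf_eq0.
  by case: c {fw} => a b /= /andP[/eqP -> /eqP ->].
have wf : fine (sqnorm setT (w n)) @[n --> \oo] --> (0 : R).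
  by apply: fine_cvg.
have : (1 + fine (sqnorm setT f)) * fine (sqnorm setT (w n)) @[n --> \oo] -->
    (1 + fine (sqnorm setT f)) * 0 by apply: cvgM wf; exact: cvg_cst.
rewrite mulr0 => /cvgr_to_ge; apply; apply: nearW => n.
by rewrite -(fw n); exact: sqmod_inner_le.
Qed.

End L2Theory.

(** * Functions of class C^k *)

Section Calculus.
Context {R : realType}.
Implicit Types (u w : R * R -> R) (k : nat) (v x : R * R).

(** A finite order of differentiability allows induction on [k] for products and compositions;
    [smooth] amounts to all orders at once. *)
Fixpoint Ck k u : Prop :=
  if k is k'.+1 then
    (forall x, differentiable u x) /\ forall v, Ck k' (fun x => 'D_v u x)
  else continuous u.

Lemma Ck_eq k u w : w =1 u -> Ck k u -> Ck k w.
Proof. by move=> /funext ->. Qed.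

Lemma Ck_continuous k u : Ck k u -> continuous u.
Proof.
by case: k => [//|k [du _]] x; exact: differentiable_continuous.
Qed.

Lemma CkW k u : Ck k.+1 u -> Ck k u.
Proof.
elim: k u => [|k IH] u; first exact: (@Ck_continuous 1).
by move=> [du Du]; split => // v; exact/IH/Du.
Qed.

Lemma Ck_derivable k u v x : Ck k.+1 u -> derivable u x v.
Proof. by move=> [du _]; exact/diff_derivable/du. Qed.

Lemma Ck_cst k (c : R) : Ck k (fun=> c).
Proof.
elim: k c => [|k IH] c; first by move=> x; exact: cvg_cst.
split=> [x|v]; first exact: differentiable_cst.
by apply: Ck_eq (IH 0) => x; exact: derive_cst.
Qed.

Lemma derive_linear (l : {linear (R * R)%type -> R}) v x : continuous l ->
  'D_v l x = l v.
Proof.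
by move=> cl; rewrite deriveE; [rewrite diff_lin|exact: linear_differentiable].
Qed.

Lemma derive_fst v x : 'D_v (@fst R R) x = v.1.
Proof. by apply: (derive_linear (l := fst)) => y; exact: cvg_fst. Qed.

Lemma derive_snd v x : 'D_v (@snd R R) x = v.2.
Proof. by apply: (derive_linear (l := snd)) => y; exact: cvg_snd. Qed.

Lemma Ck_fst k : Ck k fst.
Proof.
case: k => [|k]; first by move=> x; exact: cvg_fst.
split=> [x|v].
  by apply: (linear_differentiable (f := fst)) => y; exact: cvg_fst.
by apply: Ck_eq (Ck_cst k v.1) => x; exact: derive_fst.
Qed.

Lemma Ck_snd k : Ck k snd.
Proof.
case: k => [|k]; first by move=> x; exact: cvg_snd.
split=> [x|v].
  by apply: (linear_differentiable (f := snd)) => y; exact: cvg_snd.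
by apply: Ck_eq (Ck_cst k v.2) => x; exact: derive_snd.
Qed.

Lemma CkD k u w : Ck k u -> Ck k w -> Ck k (fun x => u x + w x).
Proof.
elim: k u w => [|k IH] u w; first by move=> cu cw x; apply: cvgD; [exact: cu|exact: cw].
move=> Cu Cw; split=> [x|v]; first by apply: differentiableD; [exact: Cu.1|exact: Cw.1].
apply: Ck_eq (IH _ _ (Cu.2 v) (Cw.2 v)) => x.
by apply: deriveD; exact: (Ck_derivable (k := k)).
Qed.

Lemma derive_mul u w v x : derivable u x v -> derivable w x v ->
  'D_v (fun y => u y * w y) x = u x * 'D_v w x + w x * 'D_v u x.
Proof. exact: deriveM. Qed.

Lemma derive_add u w v x : derivable u x v -> derivable w x v ->
  'D_v (fun y => u y + w y) x = 'D_v u x + 'D_v w x.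
Proof. exact: deriveD. Qed.

Lemma derive_sub u w v x : derivable u x v -> derivable w x v ->
  'D_v (fun y => u y - w y) x = 'D_v u x - 'D_v w x.
Proof. exact: deriveB. Qed.

Lemma CkM k u w : Ck k u -> Ck k w -> Ck k (fun x => u x * w x).
Proof.
elim: k u w => [|k IH] u w; first by move=> cu cw x; apply: cvgM; [exact: cu|exact: cw].
move=> Cu Cw; split=> [x|v]; first by apply: differentiableM; [exact: Cu.1|exact: Cw.1].
apply: Ck_eq (CkD (IH _ _ (CkW Cu) (Cw.2 v)) (IH _ _ (CkW Cw) (Cu.2 v))) => x.
by apply: derive_mul; exact: (Ck_derivable (k := k)).
Qed.

Lemma CkZ k (c : R) u : Ck k u -> Ck k (fun x => c * u x).
Proof. by apply: CkM; exact: Ck_cst. Qed.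

Lemma CkN k u : Ck k u -> Ck k (fun x => - u x).
Proof.
by move=> Cu; apply: Ck_eq (CkZ (-1) Cu) => x; rewrite mulN1r.
Qed.

Lemma derive_comp1 (g : R -> R) (dg : R) u v x : differentiable u x ->
  is_derive (u x) 1 g dg -> 'D_v (fun y => g (u y)) x = dg * 'D_v u x.
Proof.
move=> du [/derivable1_diffP dgu gE].
rewrite -/(g \o u) deriveE; last exact: differentiable_comp.
rewrite diff_comp// diff1E//= derive1E gE -deriveE//.
by rewrite /GRing.scale/= mulrC.
Qed.

(** Differentiating a cosine gives a sine, so an induction on [k] for one function alone would not
    close. It is done for a whole family in which each derivative is a multiple of some member. *)
Lemma Ck_comp_system (I : Type) (g : I -> R -> R) (d : I -> I) (s : I -> R) :
  (forall i (t : R), is_derive t 1 (g i) (s i * g (d i) t)) ->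
  forall k i u, Ck k u -> Ck k (fun x => g i (u x)).
Proof.
move=> gd; have cg i (t : R) : differentiable (g i) t.
  by apply/derivable1_diffP; have [] := gd i t.
elim=> [|k IH] i u Cu.
  by move=> x; apply: (continuous_comp (Cu x)); exact: differentiable_continuous.
split=> [x|v]; first by apply: differentiable_comp; [exact: Cu.1|exact: cg].
apply: Ck_eq (CkM (CkZ (s i) (IH (d i) _ (CkW Cu))) (Cu.2 v)) => x.
by apply: derive_comp1; exact: Cu.1.
Qed.

Lemma Ck_expR k u : Ck k u -> Ck k (fun x => expR (u x)).
Proof.
apply: (@Ck_comp_system unit (fun=> @expR R) id (fun=> 1) _ k tt) => _ t.
by rewrite mul1r; exact: is_derive_expR.
Qed.

Let trig (b : bool) : R -> R := if b then sin else cos.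

Let trigE b (t : R) : is_derive t 1 (trig b) ((if b then 1 else -1) * trig (~~ b) t).
Proof.
by case: b => /=; rewrite ?mul1r ?mulN1r; [exact: is_derive_sin|exact: is_derive_cos].
Qed.

Lemma Ck_cos k u : Ck k u -> Ck k (fun x => cos (u x)).
Proof. exact: (@Ck_comp_system _ _ _ _ trigE k false u). Qed.

Lemma Ck_sin k u : Ck k u -> Ck k (fun x => sin (u x)).
Proof. exact: (@Ck_comp_system _ _ _ _ trigE k true u). Qed.

Lemma smooth_Ck k u : smooth u -> Ck k u.
Proof.
elim: k u => [|k IH] u su.
  by move=> x; apply: differentiable_continuous; exact: (su [::]).
split=> [x|v]; first exact: (su [::]).
by apply: IH => vs x; have := su (rcons vs v) x; rewrite foldr_rcons.
Qed.

Definition vanishes_beyond (V : nmodType) (M : R) (f : R * R -> V) :=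
  forall x, M < `|x| -> f x = 0.

(** The region [M < |x|] is open, so near each of its points [u] coincides with the zero
    function. *)
Lemma derive_vanishes_beyond M u v : vanishes_beyond M u ->
  vanishes_beyond M (fun x => 'D_v u x).
Proof.
move=> uM x Mx; rewrite -[RHS](derive_cst (0 : R^o) x v).
apply: (@near_eq_derive _ _ R^o).
have oM : open [set y : R * R | M < `|y|].
  have := (continuousP _).1 (@norm_continuous R (R * R)%type) _ (@open_gt R M).
  exact.
by apply: filterS (open_nbhs_nbhs (conj oM Mx)) => y; exact: uM.
Qed.

Local Notation borel2 := (measurableTypeR R * measurableTypeR R)%type.

Lemma compact_support_integrable M u : continuous u -> vanishes_beyond M u ->
  borel_area.-integrable [set: borel2] (fun x : borel2 => (u x)%:E).
Proof.
move=> cu uM; set N := Num.max M 1.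
pose D : set borel2 := `[- N, N] `*` `[- N, N].
have mu := continuous_measurable_prod cu.
have mD : measurable D by apply: measurableX; exact: measurable_itv.
have uD : (fun x : borel2 => (u x)%:E) = (fun x : borel2 => (u x)%:E) \_ D.
  apply/funext => x; rewrite /patch; case: ifPn => //; rewrite notin_setE => xD.
  rewrite uM// ltNge; apply: contra_notN xD => xM.
  have : `|x : R * R| <= N by rewrite le_max xM.
  by rewrite ge_max !ler_norml /D/= !in_itv/= => /andP[].
rewrite uD; apply/(integrable_mkcond _ mD); apply: measurable_bounded_integrable => //.
- rewrite [X in (X < _)%E]product_measure1E; try exact: measurable_itv.
  by apply: lte_mul_pinfty => //; rewrite ?ge0_fin_numE//;
    rewrite [X in (X < _)%E]lebesgue_measure_itv; case: ifP => // _; rewrite ltry.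
- by apply: measurable_funTS.
- have cD : compact (u @` D : set R^o).
    apply: (@continuous_compact (R * R)%type R^o).
      by apply: continuous_subspaceT => x; exact: cu.
    by apply: compact_setX; exact: segment_compact.
  have [K [Kr KP]] := compact_bounded cD.
  exists K; split => // K' KK' x Dx.
  by apply: (KP _ KK'); exists x.
Qed.

End Calculus.

(** * Integration by parts *)

Section IntegrationByParts.
Context {R : realType}.

Local Notation borel2 := (measurableTypeR R * measurableTypeR R)%type.
Local Notation cfun := (R * R -> R[i]).
Local Notation re := (@complex.Re R).
Local Notation im := (@complex.Im R).
Local Notation leb := (@lebesgue_measure R).

Lemma integral_area (f : borel2 -> \bar R) : measurable_fun [set: borel2] f ->
  (\int[area]_x f x = \int[borel_area]_x f x)%E.
Proof.
move=> mf; rewrite integralE [RHS]integralE.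
rewrite (ge0_integral_area (measurable_funepos mf)) => [|x]; last exact: funepos_ge0.
by rewrite (ge0_integral_area (measurable_funeneg mf)) => // x; exact: funeneg_ge0.
Qed.

Lemma integrable_area (f : borel2 -> \bar R) :
  borel_area.-integrable [set: borel2] f ->
  area.-integrable [set: plane R] (f : plane R -> \bar R).
Proof.
move=> /integrableP[mf fin]; apply/integrableP; split.
  exact: measurable_fun_plane.
rewrite (ge0_integral_area (f := fun x => `|f x|%E))//.
exact: measurableT_comp mf.
Qed.

Lemma compact_support_integrable_area M (u : R * R -> R) : continuous u ->
  vanishes_beyond M u ->
  area.-integrable [set: plane R] (fun x : plane R => (u x)%:E).
Proof. by move=> cu uM; exact/integrable_area/(compact_support_integrable cu uM). Qed.

(** This is the fundamental theorem of calculus on [[-M, M]]. The non-strict condition [M <= |t|]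
    covers the end points, so both boundary terms vanish. *)
Lemma integral_derive_eq0 (w dw : R -> R) (M : R) : 0 < M ->
  (forall t : R, is_derive t 1 w (dw t)) -> continuous dw ->
  (forall t, M <= `|t| -> w t = 0) -> (forall t, M <= `|t| -> dw t = 0) ->
  (\int[leb]_t (dw t)%:E = 0)%E.
Proof.
move=> M0 dwE cdw wM dwM.
have cw : continuous w.
  by move=> t; apply: differentiable_continuous; apply/derivable1_diffP; exact: ex_derive.
rewrite (_ : (fun t => (dw t)%:E) = (EFin \o dw) \_ `[- M, M]); last first.
  apply/funext => t; rewrite /patch; case: ifPn => //; rewrite notin_setE /= in_itv/=.
  by rewrite -ler_norml => /negP; rewrite -ltNge => /ltW/dwM ->.
rewrite -integral_mkcond (@continuous_FTC2 _ dw w (- M) M).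
- by rewrite !wM ?normrN ?ler_norm// subee.
- lra.
- exact: continuous_subspaceT.
- split=> [t _||]; first exact: ex_derive.
    exact/cvg_at_right_filter/cw.
  exact/cvg_at_left_filter/cw.
- by move=> t _; rewrite derive1E; exact: derive_val.
Qed.

Lemma is_derive_line (u : R * R -> R) (p v : R * R) (t : R) :
  differentiable u (p + t *: v) ->
  is_derive t 1 (fun s : R => u (p + s *: v)) ('D_v u (p + t *: v)).
Proof.
move=> du; have duv := @diff_derivable _ _ _ u _ v du.
have E : (fun h : R => h^-1 *: (((fun s : R => u (p + s *: v)) \o shift t) (h *: 1)
    - u (p + t *: v))) =
  (fun h : R => h^-1 *: ((u \o shift (p + t *: v)) (h *: v) - u (p + t *: v))).
  apply/funext => h /=; congr (_ *: (u _ - _)).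
  by rewrite scalerDl addrCA -scalerA scale1r.
by split; rewrite /derivable /derive E.
Qed.

(** By Fubini, since on each line parallel to [v] the integrand is the derivative of a function of
    bounded support. *)
Lemma integral_partial_eq0 (M : R) (u : R * R -> R) (v : R * R) :
  v = (1, 0) \/ v = (0, 1) -> Ck 1 u -> vanishes_beyond M u ->
  \int[area]_x 'D_v u x = 0.
Proof.
move=> vE [du Cu] uM; have Du0 := derive_vanishes_beyond v uM.
have cDu := Cu v.
(* [u] is known to vanish only strictly beyond [M], and [M] may be negative, while the
   one-dimensional lemma asks for a positive radius from which on everything is zero. *)
pose N := Num.max M 0 + 1.
have MN : M < N by rewrite ltr_pwDr// le_max lexx.
have N0 : 0 < N by rewrite ltr_wpDl// le_max lexx orbT.
rewrite /Rintegral (integral_area (f := fun x => ('D_v u x)%:E)); last first.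
  by apply/measurable_EFinP; exact: continuous_measurable_prod.
have iDu := compact_support_integrable cDu Du0.
have line (p : R * R) (q : R -> R * R) : (forall s, q s = p + s *: v) ->
    (forall s, `|s| <= `|q s|) ->
    (\int[leb]_s ('D_v u (q s))%:E = 0)%E.
  move=> qE sq; apply: (@integral_derive_eq0 (u \o q) _ N) => //.
  - move=> s; rewrite (_ : u \o q = fun s => u (p + s *: v)).
      by rewrite qE; apply: is_derive_line; exact: du.
    by apply/funext => s' /=; rewrite qE.
  - have cq : continuous q.
      rewrite (_ : q = fun s => p + s *: v); last exact/funext.
      by move=> s; apply: cvgD; [exact: cvg_cst|apply: cvgZr_tmp; exact: cvg_id].
    by move=> s; exact: (continuous_comp (cq s) (cDu (q s))).
  - by move=> s Ns; apply: uM; exact: lt_le_trans MN (le_trans Ns (sq s)).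
  - by move=> s Ns; apply: Du0; exact: lt_le_trans MN (le_trans Ns (sq s)).
have le_max1 (a b : R) : `|a| <= `|(a, b)| by rewrite [leRHS]/Num.norm/= le_max lexx.
have le_max2 (a b : R) : `|b| <= `|(a, b)| by rewrite [leRHS]/Num.norm/= le_max lexx orbT.
(* The order of integration is chosen so that the inner integral runs in the direction [v]. *)
case: vE => vE.
  rewrite -(integral21_prod_meas1 iDu) integral0_eq// => y _.
  apply: (line (0, y) (fun s => (s, y))) => // s; rewrite vE.
  by congr pair; rewrite /= /GRing.scale/= ?mulr1 ?mulr0 ?add0r ?addr0.
rewrite -(integral12_prod_meas1 iDu) integral0_eq// => y _.
apply: (line (y, 0) (fun s => (y, s))) => // s; rewrite vE.
by congr pair; rewrite /= /GRing.scale/= ?mulr1 ?mulr0 ?add0r ?addr0.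
Qed.

End IntegrationByParts.

(** * The Landau operator on test functions *)

Section Magnetic.
Context {R : realType}.

Local Notation cfun := (R * R -> R[i]).
Local Notation re := (@complex.Re R).
Local Notation im := (@complex.Im R).
Implicit Types (f g psi : cfun) (p : R * R -> R) (v x : R * R) (k : nat).

Definition cCk k f := Ck k (re \o f) /\ Ck k (im \o f).

(** Common form [i D_v + p] of both magnetic derivatives, with a real potential [p], so that
    symmetry and linearity are proved once. *)
Definition magnetic v p f : cfun := fun x => 'i%C * cpartial v f x + (p x)%:C%C * f x.

Lemma magnetic1E (B : R) : magnetic1 B = magnetic (1, 0) (fun x => - (B / 2 * x.2)).
Proof.
apply/funext => f; apply/funext => x; rewrite /magnetic1 /magnetic -mulNr.
by congr (_ + _ * _); rewrite rmorphN.
Qed.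

Lemma magnetic2E (B : R) : magnetic2 B = magnetic (0, 1) (fun x => B / 2 * x.1).
Proof. by []. Qed.

Lemma re_magnetic v p f x : re (magnetic v p f x) =
  p x * re (f x) - 'D_v (im \o f) x.
Proof. by rewrite /magnetic /cpartial; case: (f x) => a b /=; ring. Qed.

Lemma im_magnetic v p f x : im (magnetic v p f x) =
  p x * im (f x) + 'D_v (re \o f) x.
Proof. by rewrite /magnetic /cpartial; case: (f x) => a b /=; ring. Qed.

Lemma cCkW k f : cCk k.+1 f -> cCk k f.
Proof. by move=> [Cr Ci]; split; exact: CkW. Qed.

Lemma cCk_magnetic k v p f : Ck k p -> cCk k.+1 f -> cCk k (magnetic v p f).
Proof.
move=> Cp Cf; have [Cr Ci] := Cf; have [Cr' Ci'] := cCkW Cf; split.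
  apply: Ck_eq (CkD (CkM Cp Cr') (CkN (Ci.2 v))) => x.
  exact: re_magnetic.
by apply: Ck_eq (CkD (CkM Cp Ci') (Cr.2 v)) => x; exact: im_magnetic.
Qed.

Lemma cCk_lin k (c : R[i]) f g : cCk k f -> cCk k g ->
  cCk k (fun x => c * f x + g x).
Proof.
move=> [fr fi] [gr gi]; split.
  apply: Ck_eq (CkD (CkZ (re c) fr) (CkD (CkZ (- im c) fi) gr)) => x /=.
  by case: c (f x) (g x) => ? ? [? ?] [? ?] /=; ring.
apply: Ck_eq (CkD (CkZ (re c) fi) (CkD (CkZ (im c) fr) gi)) => x /=.
by case: c (f x) (g x) => ? ? [? ?] [? ?] /=; ring.
Qed.

Lemma cCkM k f g : cCk k f -> cCk k g -> cCk k (fun x => f x * g x).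
Proof.
move=> [fr fi] [gr gi]; split.
  apply: Ck_eq (CkD (CkM fr gr) (CkN (CkM fi gi))) => x /=.
  by case: (f x) (g x) => ? ? [? ?].
apply: Ck_eq (CkD (CkM fr gi) (CkM fi gr)) => x /=.
by case: (f x) (g x) => ? ? [? ?].
Qed.

Lemma cCk_conjc k f : cCk k f -> cCk k (fun x => conjc (f x)).
Proof.
move=> [fr fi]; split.
  by apply: Ck_eq fr => x /=; case: (f x).
by apply: Ck_eq (CkN fi) => x /=; case: (f x).
Qed.

Lemma vanishes_magnetic M v p f : vanishes_beyond M f ->
  vanishes_beyond M (magnetic v p f).
Proof.
move=> fM.
have fr : vanishes_beyond M (re \o f) by move=> x /fM /= ->.
have fi : vanishes_beyond M (im \o f) by move=> x /fM /= ->.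
move=> x Mx; apply/eqP; rewrite eq_complex re_magnetic im_magnetic.
rewrite (derive_vanishes_beyond v fr Mx) (derive_vanishes_beyond v fi Mx).
by rewrite fM//= !mulr0 subr0 addr0 eqxx.
Qed.

Lemma compact_support_L2 M f : cCk 0 f -> vanishes_beyond M f -> L2 f.
Proof.
move=> [cr ci] fM; apply/L2P; split.
- by apply: measurable_fun_plane; exact: continuous_measurable_prod.
- by apply: measurable_fun_plane; exact: continuous_measurable_prod.
- have sM : vanishes_beyond M (fun x => sqmod (f x)).
    by move=> x /fM ->; rewrite /sqmod /= expr0n addr0.
  have cs : continuous (fun x => sqmod (f x)).
    apply: (@Ck_continuous _ 0).
    exact: Ck_eq (CkD (CkM (cr : Ck 0 _) cr) (CkM (ci : Ck 0 _) ci)).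
  exact: (integrable_lty measurableT (compact_support_integrable_area cs sM)).
Qed.

(** As [p] is real, the two integrands differ by [i D_v h] with [h = conj(f) psi], and this
    integrates to 0 because [psi] has bounded support. In real and imaginary parts the difference is
    [- D_v (im h)] and [D_v (re h)], whence the coefficients -1 and 1 passed to [parts]. *)
Lemma magnetic_sym M v p f psi : v = (1, 0) \/ v = (0, 1) -> continuous p ->
  cCk 1 f -> cCk 1 psi -> vanishes_beyond M psi ->
  inner f (magnetic v p psi) = inner (magnetic v p f) psi.
Proof.
move=> vE cp Cf Cpsi psiM.
pose h x := conjc (f x) * psi x.
have [Cw Cz] : cCk 1 h by apply: cCkM => //; exact: cCk_conjc.
have wM : vanishes_beyond M (re \o h) by move=> x /psiM; rewrite /h /= => ->; rewrite mulr0.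
have zM : vanishes_beyond M (im \o h) by move=> x /psiM; rewrite /h /= => ->; rewrite mulr0.
pose r x := conjc (magnetic v p f x) * psi x.
have [Cr Ci] : cCk 0 r.
  by apply: cCkM; [apply/cCk_conjc/cCk_magnetic|exact: cCkW].
have rM : vanishes_beyond M (re \o r) by move=> x /psiM; rewrite /r /= => ->; rewrite mulr0.
have iM : vanishes_beyond M (im \o r) by move=> x /psiM; rewrite /r /= => ->; rewrite mulr0.
have [[fr _] [fi _]] := Cf; have [[pr _] [pi _]] := Cpsi.
have DM (a b : R * R -> R) x : (forall x, differentiable a x) ->
    (forall x, differentiable b x) ->
    'D_v (fun y => a y * b y) x = a x * 'D_v b x + b x * 'D_v a x.
  by move=> da db; apply: derive_mul; exact: diff_derivable.
have Dw x : 'D_v (re \o h) x = 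
    (re (f x) * 'D_v (re \o psi) x + re (psi x) * 'D_v (re \o f) x) +
    (im (f x) * 'D_v (im \o psi) x + im (psi x) * 'D_v (im \o f) x).
  rewrite -(DM (re \o f) (re \o psi))// -(DM (im \o f) (im \o psi))// -derive_add.
  - congr ('D_v _ x); apply/funext => y; rewrite /h /=.
    by case: (f y) (psi y) => ? ? [? ?] /=; ring.
  - by apply: diff_derivable; exact: differentiableM.
  - by apply: diff_derivable; exact: differentiableM.
have Dz x : 'D_v (im \o h) x = 
    (re (f x) * 'D_v (im \o psi) x + im (psi x) * 'D_v (re \o f) x) -
    (im (f x) * 'D_v (re \o psi) x + re (psi x) * 'D_v (im \o f) x).
  rewrite -(DM (re \o f) (im \o psi))// -(DM (im \o f) (re \o psi))// -derive_sub.
  - congr ('D_v _ x); apply/funext => y; rewrite /h /=.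
    by case: (f y) (psi y) => ? ? [? ?] /=; ring.
  - by apply: diff_derivable; exact: differentiableM.
  - by apply: diff_derivable; exact: differentiableM.
have parts (s t : R * R -> R) (c : R) : Ck 0 s -> vanishes_beyond M s -> Ck 1 t ->
    vanishes_beyond M t ->
    \int[area]_x (s x + c * 'D_v t x) = \int[area]_x s x.
  move=> Cs sM Ct tM.
  have iD := compact_support_integrable_area (Ct.2 v) (derive_vanishes_beyond v tM).
  rewrite (RintegralD measurableT (compact_support_integrable_area Cs sM)
    (integrableZl measurableT c iD)).
  by rewrite (RintegralZl c measurableT iD) (integral_partial_eq0 vE Ct tM) mulr0 addr0.
rewrite /inner -(parts _ _ (-1) Cr rM Cz zM) -(parts _ _ 1 Ci iM Cw wM).
congr (_ +i* _)%C; apply: eq_Rintegral => x _.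
  rewrite Dz /r /=; have := re_magnetic v p psi x; have := im_magnetic v p psi x.
  have := re_magnetic v p f x; have := im_magnetic v p f x.
  case: (magnetic v p f x) (magnetic v p psi x) => ? ? [? ?] /= -> -> -> ->.
  by case: (f x) (psi x) => ? ? [? ?] /=; ring.
rewrite Dw /r /=; have := re_magnetic v p psi x; have := im_magnetic v p psi x.
have := re_magnetic v p f x; have := im_magnetic v p f x.
case: (magnetic v p f x) (magnetic v p psi x) => ? ? [? ?] /= -> -> -> ->.
by case: (f x) (psi x) => ? ? [? ?] /=; ring.
Qed.

(** Integrability comes from the bounded support of [psi], so [f] and [g] may be derivatives of a
    function in L2 that are not themselves known to be in L2. *)
Lemma inner_Dl_compact_support M f g psi : cCk 0 f -> cCk 0 g -> cCk 0 psi ->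
  vanishes_beyond M psi ->
  inner (fun x => f x + g x) psi = inner f psi + inner g psi.
Proof.
move=> Cf Cg Cpsi psiM.
have int (h : cfun) : cCk 0 h ->
    area.-integrable [set: plane R] (EFin \o (fun x => re (conjc (h x) * psi x))) /\
    area.-integrable [set: plane R] (EFin \o (fun x => im (conjc (h x) * psi x))).
  move=> Ch; have [cr ci] : cCk 0 (fun x => conjc (h x) * psi x).
    by apply: cCkM => //; exact: cCk_conjc.
  by split; [apply: (compact_support_integrable_area (M := M) cr)|
    apply: (compact_support_integrable_area (M := M) ci)] => x /psiM /= ->; rewrite mulr0.
have [fr fi] := int f Cf; have [gr gi] := int g Cg.
apply/eqP; rewrite eq_complex; apply/andP; split; apply/eqP.
  apply: etrans (RintegralD measurableT fr gr).
  by apply: eq_Rintegral => x _ /=; case: (f x) (g x) (psi x) => ? ? [? ?] [? ?] /=; ring.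
apply: etrans (RintegralD measurableT fi gi).
by apply: eq_Rintegral => x _ /=; case: (f x) (g x) (psi x) => ? ? [? ?] [? ?] /=; ring.
Qed.

Lemma magnetic_lin v p (c : R[i]) f g x : cCk 1 f -> cCk 1 g ->
  magnetic v p (fun x => c * f x + g x) x = c * magnetic v p f x + magnetic v p g x.
Proof.
move=> [[fr _] [fi _]] [[gr _] [gi _]].
have dlin (a b : R) (u1 u2 u3 : R * R -> R) : (forall x, differentiable u1 x) ->
    (forall x, differentiable u2 x) -> (forall x, differentiable u3 x) ->
    'D_v (fun x => a * u1 x + b * u2 x + u3 x) x =
    a * 'D_v u1 x + b * 'D_v u2 x + 'D_v u3 x.
  move=> d1 d2 d3.
  have dZ (s : R) (u : R * R -> R) : (forall x, differentiable u x) ->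
      derivable (fun x => s * u x) x v /\ 'D_v (fun x => s * u x) x = s * 'D_v u x.
    by move=> du; split; [apply: derivableZ|apply: deriveZ]; exact: diff_derivable.
  have [a1 a2] := dZ a u1 d1; have [b1 b2] := dZ b u2 d2.
  have d3' : derivable u3 x v by exact: diff_derivable.
  by rewrite (derive_add (derivableD a1 b1) d3') (derive_add a1 b1) a2 b2.
apply/eqP; rewrite eq_complex re_magnetic im_magnetic.
have -> : re \o (fun x => c * f x + g x) =
    fun x => re c * (re \o f) x + - im c * (im \o f) x + (re \o g) x.
  by apply/funext => y /=; case: c (f y) (g y) => ? ? [? ?] [? ?] /=; ring.
have -> : im \o (fun x => c * f x + g x) =
    fun x => re c * (im \o f) x + im c * (re \o f) x + (im \o g) x.
  by apply/funext => y /=; case: c (f y) (g y) => ? ? [? ?] [? ?] /=; ring.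
rewrite !dlin// /magnetic /cpartial.
by case: c (f x) (g x) => ? ? [? ?] [? ?] /=; apply/andP; split; apply/eqP; ring.
Qed.

Lemma Ck_smooth (u : R * R -> R) : (forall k, Ck k u) -> smooth u.
Proof.
move=> Cu vs; have : forall k, Ck k (foldr (fun v w => 'D_v w) u vs).
  by elim: vs => [//|v vs IH] k /=; exact: (IH k.+1).2.
by move=> /(_ 1%N) [].
Qed.

Lemma test_function_cCk k f : test_function f -> cCk k f.
Proof. by move=> [sr si _]; split; exact: smooth_Ck. Qed.

Lemma test_function_vanishes f : test_function f -> exists M, vanishes_beyond M f.
Proof.
move=> [_ _ /compact_bounded[K [Kr KP]]]; exists (K + 1) => x Kx.
apply/eqP; apply: contraTT Kx => fx0; rewrite -leNgt.
by apply: (KP (K + 1)); [rewrite ltrDl|exact: subset_closure].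
Qed.

Lemma test_function_lin (c : R[i]) f g : test_function f -> test_function g ->
  test_function (fun x => c * f x + g x).
Proof.
move=> tf tg; have Cl k := cCk_lin c (test_function_cCk k tf) (test_function_cCk k tg).
split; try by apply: Ck_smooth => k; case: (Cl k).
have [_ _ cf] := tf; have [_ _ cg] := tg.
apply: (subclosed_compact _ (compactU cf cg)); first exact: closed_closure.
rewrite -closureU; apply: closureS => x /=; apply: contra_neqP => /not_orP[fx gx].
move: fx gx => /negP; rewrite negbK => /eqP -> /negP; rewrite negbK => /eqP ->.
by rewrite mulr0 addr0.
Qed.

(** * Linearity of the Landau operator and its weak eigenvalue equation *)

Section Landau.
Context (B : R).

Let p1 x : R := - (B / 2 * x.2).
Let p2 x : R := B / 2 * x.1.

Let Cp1 k : Ck k p1.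
Proof. by apply: CkN; apply: CkZ; exact: Ck_snd. Qed.

Let Cp2 k : Ck k p2.
Proof. by apply: CkZ; exact: Ck_fst. Qed.

Lemma landau_exprE f : landau_expr B f = fun x =>
  magnetic (1, 0) p1 (magnetic (1, 0) p1 f) x +
  magnetic (0, 1) p2 (magnetic (0, 1) p2 f) x.
Proof. by rewrite /landau_expr magnetic1E magnetic2E. Qed.

Lemma landau_expr_lin (c : R[i]) f g : cCk 2 f -> cCk 2 g ->
  landau_expr B (fun x => c * f x + g x) =
  fun x => c * landau_expr B f x + landau_expr B g x.
Proof.
move=> Cf Cg; rewrite !landau_exprE; apply/funext => x.
have lin v p : (forall k, Ck k p) ->
    magnetic v p (magnetic v p (fun x => c * f x + g x)) x =
    c * magnetic v p (magnetic v p f) x + magnetic v p (magnetic v p g) x.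
  move=> Cp; have C1 := cCk_magnetic v (Cp 1%N) Cf; have C2 := cCk_magnetic v (Cp 1%N) Cg.
  rewrite -(magnetic_lin v p c x C1 C2); congr (magnetic v p _ x).
  by apply/funext => y; exact: magnetic_lin (cCkW Cf) (cCkW Cg).
apply: etrans (congr2 +%R (lin (1, 0) p1 Cp1) (lin (0, 1) p2 Cp2)) _.
by rewrite [in RHS]mulrDr addrACA.
Qed.

Lemma test_function_L2 f : test_function f -> L2 f /\ L2 (landau_expr B f).
Proof.
move=> tf; have C k := test_function_cCk k tf.
have [M fM] := test_function_vanishes tf; split.
  exact: compact_support_L2 (C 0) fM.
rewrite landau_exprE; apply: L2D;
  (apply: (compact_support_L2 (M := M)); last by do 2 apply: vanishes_magnetic);
  by apply: cCk_magnetic => //; apply: cCk_magnetic.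
Qed.

(** By the parallelogram identity, the right side minus the left side is [|g - c f|^2]. *)
Lemma sqnorm_lin_le (c : R[i]) f g : L2 f -> L2 g ->
  (sqnorm setT (fun x => (c * f x + g x)%R) <=
  (2 * sqmod c)%:E * sqnorm setT f + 2%:E * sqnorm setT g)%E.
Proof.
move=> fL gL.
rewrite -(fineK (sqnorm_fin_num fL)) -(fineK (sqnorm_fin_num gL)).
have : (0 <= sqnorm setT (fun x => (- c * f x + g x)%R))%E.
  by apply: integral_ge0 => x _; rewrite lee_fin sqmod_ge0.
rewrite !sqnorm_lin// -!EFinM -EFinD !lee_fin.
case: c (inner g f) => a b [s t]; rewrite /sqmod /= => h.
by lra.
Qed.

Lemma sqnorm_lin_cvg0 (c : R[i]) (F G : nat -> cfun) :
  (forall n, L2 (F n)) -> (forall n, L2 (G n)) ->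
  sqnorm setT (F n) @[n --> \oo] --> 0%E ->
  sqnorm setT (G n) @[n --> \oo] --> 0%E ->
  sqnorm setT (fun x => c * F n x + G n x) @[n --> \oo] --> 0%E.
Proof.
move=> FL GL F0 G0.
have lim0 : ((2 * sqmod c)%:E * sqnorm setT (F n) + 2%:E * sqnorm setT (G n))%E
    @[n --> \oo] --> 0%E.
  have FZ := cvgeZl (y := (2 * sqmod c)%:E) isT F0.
  have GZ := cvgeZl (y := 2%:E) isT G0.
  rewrite mule0 in FZ; rewrite mule0 in GZ.
  by rewrite -[X in _ --> X](adde0 0%E); apply: cvgeD FZ GZ.
apply: (squeeze_cvge _ (cvg_cst _) lim0); apply: nearW => n.
apply/andP; split; last exact: sqnorm_lin_le.
by apply: integral_ge0 => x _; rewrite lee_fin sqmod_ge0.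
Qed.

Lemma landau_lin (c : R[i]) f g (u w : cfun) : landau B f u -> landau B g w ->
  landau B (fun x => c * f x + g x) (fun x => c * u x + w x).
Proof.
move=> [fL uL [phi [tphi phif phiu]]] [gL wL [psi [tpsi psig psiw]]].
split; [exact: L2_lin|exact: L2_lin|].
exists (fun n x => c * phi n x + psi n x).
have lin (F G : nat -> cfun) f' g' : (forall n, L2 (F n)) -> (forall n, L2 (G n)) ->
    L2 f' -> L2 g' ->
    sqnorm setT (fun x => F n x - f' x) @[n --> \oo] --> 0%E ->
    sqnorm setT (fun x => G n x - g' x) @[n --> \oo] --> 0%E ->
    sqnorm setT (fun x => (c * F n x + G n x) - (c * f' x + g' x))
      @[n --> \oo] --> 0%E.
  move=> FL GL f'L g'L Ff Gg.
  have := sqnorm_lin_cvg0 c (fun n => L2B (FL n) f'L) (fun n => L2B (GL n) g'L) Ff Gg.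
  rewrite (_ : (fun n => sqnorm setT _) = fun n => sqnorm setT
      (fun x => (c * F n x + G n x) - (c * f' x + g' x)))//.
  apply/funext => n; congr sqnorm; apply/funext => x.
  by rewrite mulrBr addrACA opprD.
have T n := test_function_L2 (tphi n); have T' n := test_function_L2 (tpsi n).
split=> [n||].
- exact: test_function_lin.
- exact: (lin _ _ _ _ (fun n => (T n).1) (fun n => (T' n).1) fL gL phif psig).
- rewrite (_ : (fun n => _) = fun n => sqnorm setT (fun x =>
      (c * landau_expr B (phi n) x + landau_expr B (psi n) x) - (c * u x + w x))).
    exact: (lin _ _ _ _ (fun n => (T n).2) (fun n => (T' n).2) uL wL phiu psiw).
  apply/funext => n; congr sqnorm; apply/funext => x.
  by rewrite landau_expr_lin//; exact: test_function_cCk.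
Qed.

(** Against a test function, both magnetic derivatives can be moved onto [f] by symmetry, where the
    pointwise equation applies. The definition of [landau] as a closure then gives the identity on
    the whole graph. *)
Lemma landau_weak f (b : R) : L2 f -> cCk 2 f ->
  (forall x, landau_expr B f x = b%:C%C * f x) ->
  forall h g, landau B h g -> inner f g = b%:C%C * inner f h.
Proof.
move=> fL Cf fE h g [hL gL [phi [tphi phih phig]]].
have test_sym psi : test_function psi ->
    inner f (landau_expr B psi) = b%:C%C * inner f psi.
  move=> tpsi; have C k := test_function_cCk k tpsi.
  have [M psiM] := test_function_vanishes tpsi.
  have [psiL HpsiL] := test_function_L2 tpsi.
  have twice v p : v = (1, 0) \/ v = (0, 1) -> (forall k, Ck k p) ->
      inner f (magnetic v p (magnetic v p psi)) =
      inner (magnetic v p (magnetic v p f)) psi.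
    move=> vE Cp; have cp : continuous p by exact: (Cp 0).
    apply: etrans (magnetic_sym vE cp (cCkW Cf) (cCk_magnetic v (Cp 1%N) (C 2%N))
      (vanishes_magnetic v p psiM)) _.
    exact: (magnetic_sym vE cp (cCk_magnetic v (Cp 1%N) Cf) (C 1%N) psiM).
  have mm v p (q : cfun) : (forall k, Ck k p) -> cCk 2 q ->
      cCk 0 (magnetic v p (magnetic v p q)).
    by move=> Cp Cq; exact: (cCk_magnetic v (Cp 0%N) (cCk_magnetic v (Cp 1%N) Cq)).
  have mmL v p (Cp : forall k, Ck k p) := compact_support_L2 (mm v p _ Cp (C 2%N))
    (vanishes_magnetic v p (vanishes_magnetic v p psiM)).
  rewrite landau_exprE; apply: etrans (innerDr fL (mmL _ _ Cp1) (mmL _ _ Cp2)) _.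
  apply: etrans (congr2 +%R (twice _ _ (or_introl erefl) Cp1)
    (twice _ _ (or_intror erefl) Cp2)) _.
  apply: etrans (esym (inner_Dl_compact_support (mm _ _ _ Cp1 Cf) (mm _ _ _ Cp2 Cf)
    (C 0%N) psiM)) _.
  rewrite -landau_exprE (_ : landau_expr B f = fun x => b%:C%C * f x); last exact/funext.
  rewrite (innerC psiL (L2Z _ fL)) (innerZr _ psiL fL) (innerC fL psiL).
  case: (inner f psi) => s t.
  by apply/eqP; rewrite eq_complex/=; apply/andP; split; apply/eqP; ring.
have T n := test_function_L2 (tphi n).
have dL n : L2 (fun x => phi n x - h x) by apply: L2B => //; exact: (T n).1.
have dHL n : L2 (fun x => landau_expr B (phi n) x - g x).
  by apply: L2B => //; exact: (T n).2.
(* With [H] the differential expression, [(H phi_n - g) - b (phi_n - h)] tends to 0 in L2, while its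
   inner product with [f] has the constant value [b <f, h> - <f, g>] by the identity for test
   functions. *)
apply/eqP; rewrite eq_sym -subr_eq0; apply/eqP.
apply: (inner_sqnorm_cvg0 fL (fun n => L2_lin (- b%:C%C) (dL n) (dHL n)) _
  (sqnorm_lin_cvg0 _ dL dHL phih phig)) => n.
rewrite (inner_linr _ fL (dL n) (dHL n)) (innerBr fL (T n).1 hL).
rewrite (innerBr fL (T n).2 gL) (test_sym _ (tphi n)).
by ring.
Qed.

End Landau.
End Magnetic.

(** * Weak eigenvectors and the spectral measure *)

Section Spectral.
Context {R : realType}.

Local Notation cfun := (R * R -> R[i]).
Local Notation mR := (measurableTypeR R).
Local Notation re := (@complex.Re R).
Local Notation im := (@complex.Im R).

Lemma setC_null_ae (m : {measure set mR -> \bar R}) (A : set mR) :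
  measurable A -> m (~` A) = 0%E -> \forall t \ae m, A t.
Proof. by move=> mA mA0; exists (~` A); split => //; exact: measurableC. Qed.

(** Almost everywhere the integrand equals its truncation at [r ^+ 2], which is bounded on the whole
    line, and the total mass is finite. *)
Lemma integral_sqr_lty (m : {measure set mR -> \bar R}) (A : set mR) (r : R) :
  measurable A -> m (~` A) = 0%E -> (m setT < +oo)%E ->
  (forall t : R, A t -> `|t| <= r) -> (\int[m]_t (t ^+ 2)%:E < +oo)%E.
Proof.
move=> mA mA0 mfin Ar.
have msq : measurable_fun [set: mR] (fun t : mR => (t ^+ 2)%:E).
  by apply/measurable_EFinP; apply: measurable_funX; exact: measurable_id.
rewrite (ae_eq_integral (fun t : mR => (Num.min (t ^+ 2) (r ^+ 2))%:E) _
  measurableT msq).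
- apply: (@le_lt_trans _ _ (\int[m]_t (cst (r ^+ 2)%:E) t)%E).
    apply: (ge0_le_integral m measurableT) => [t _| | |t _].
    + by rewrite lee_fin le_min !sqr_ge0.
    + apply/measurable_EFinP; apply: measurable_minr; last exact: measurable_cst.
      by apply: measurable_funX; exact: measurable_id.
    + exact: measurable_cst.
    + by rewrite lee_fin ge_min lexx orbT.
  by rewrite integral_cst// lte_mul_pinfty// lee_fin sqr_ge0.
- apply/measurable_EFinP; apply: measurable_minr; last exact: measurable_cst.
  by apply: measurable_funX; exact: measurable_id.
- apply: filterS (setC_null_ae mA mA0) => t At _ /=.
  rewrite (min_idPl _)// -[leLHS]real_normK ?num_real//.
  by rewrite lerXn2r ?nnegrE ?Ar// (le_trans _ (Ar _ At)).
Qed.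

(** The first moment of a measure carried by [[a, d]] is at least [a] times the mass; being also [b]
    times the mass with [b < a], it forces the mass to be 0. *)
Lemma null_of_mean (m : {measure set mR -> \bar R}) (a d b : R) :
  m (~` `[a, d]%classic) = 0%E -> (m setT < +oo)%E -> b < a ->
  \int[m]_t t = b * fine (m setT) -> m setT = 0%E.
Proof.
move=> m0 mfin ba.
have mTfin : m setT \is a fin_num by rewrite ge0_fin_numE.
(* The clamp of [t] agrees with [t] almost everywhere and is at least [a]. *)
pose F (t : mR) := Num.max (Num.min t d) a.
have mF : measurable_fun setT F.
  apply: measurable_maxr; last exact: measurable_cst.
  by apply: measurable_minr; [exact: measurable_id|exact: measurable_cst].
have -> : \int[m]_t t = \int[m]_t F t.
  congr fine; apply: (ae_eq_integral _ _ measurableT).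
  - by apply/measurable_EFinP; exact: measurable_id.
  - exact/measurable_EFinP.
  - pose I : set mR := `[a, d]%classic.
    have mI : measurable I by exact: measurable_itv.
    apply: filterS (setC_null_ae mI m0) => t; rewrite /I/= in_itv/=.
    by move=> /andP[aX td] _; rewrite /F (min_idPl _)// (max_idPl _).
have iF : m.-integrable setT (EFin \o F).
  apply: (@measurable_bounded_integrable _ _ _ m) => //.
  exists (`|a| + `|d|); split; first exact: num_real.
  move=> M aM t _; apply: ltW; apply: le_lt_trans aM.
  rewrite /F; case: (leP (Num.min t d) a) => [_|]; first by rewrite lerDl.
  case: (leP t d) => [td at_|_ _]; last by rewrite lerDr.
  have := ler_norm d; have := ler_norm (- a); rewrite normrN.
  by have := normr_ge0 a; have := normr_ge0 d; rewrite ler_norml; lra.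
have iC : m.-integrable setT (EFin \o cst a).
  apply: (@measurable_bounded_integrable _ _ _ m) => //.
  by exists `|a|; split => [|M aM t _]; [exact: num_real|exact: ltW].
have aF t : [set: mR] t -> cst a t <= F t by rewrite /F le_max lexx orbT.
move=> Fb; have := le_Rintegral measurableT iC iF aF.
rewrite Rintegral_cst// Fb => h.
have := fine_ge0 (measure_ge0 m setT) => h0.
have : fine (m setT) = 0 by nra.
by move=> m00; rewrite -(fineK mTfin) m00.
Qed.

(** * Spectral projections of a linear operator given by its graph *)

Context (H : cfun -> cfun -> Prop) (P : set mR -> cfun -> cfun).
Context (HL2 : forall f u, H f u -> L2 f /\ L2 u)
  (Hlin : forall (c : R[i]) f g u v, H f u -> H g v ->
    H (fun x => c * f x + g x) (fun x => c * u x + v x))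
  (HP : spectral_measure H P).

Let PL2 A f : measurable A -> L2 f -> L2 (P A f).
Proof. by case: HP => + _ _ _ mA => /(_ A mA)[+ _ _ _ _]; exact. Qed.

Let P_lin A (c : R[i]) f g : measurable A -> L2 f -> L2 g ->
  aeeq (P A (fun x => c * f x + g x)) (fun x => c * P A f x + P A g x).
Proof. by case: HP => + _ _ _ mA => /(_ A mA)[_ _ + _ _]; exact. Qed.

Let P_idem A f : measurable A -> L2 f -> aeeq (P A (P A f)) (P A f).
Proof. by case: HP => + _ _ _ mA => /(_ A mA)[_ _ _ + _]; exact. Qed.

Let P_sym A f g : measurable A -> L2 f -> L2 g ->
  inner (P A f) g = inner f (P A g).
Proof. by case: HP => + _ _ _ mA => /(_ A mA)[_ _ _ _ +]; exact. Qed.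

Let P_T f : L2 f -> aeeq (P setT f) f.
Proof. by case: HP => _ + _ _; exact. Qed.

Let P_I A A' f : measurable A -> measurable A' -> L2 f ->
  aeeq (P (A `&` A') f) (P A (P A' f)).
Proof. by case: HP => _ _ + _; exact. Qed.

Let mass f : L2 f -> exists m : {measure set mR -> \bar R},
  [/\ forall A, measurable A -> m A = sqnorm setT (P A f),
      (exists g, H f g) <-> (\int[m]_t (t ^+ 2)%:E < +oo)%E &
      forall g, H f g -> inner f g = (\int[m]_t t)%R%:C%C].
Proof. by case: HP => _ _ _; exact. Qed.

Let P_set0 f : L2 f -> aeeq (P set0 f) (fun=> 0).
Proof.
move=> fL; have [m [mE _ _]] := mass fL.
apply: sqnorm_eq0; first exact: PL2.
by rewrite -(mE _ measurable0) measure0.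
Qed.

Let mass_comp A f A' : measurable A -> measurable A' -> L2 f ->
  sqnorm setT (P A' (P A f)) = sqnorm setT (P (A' `&` A) f).
Proof.
move=> mA mA' fL; apply/esym.
exact: (sqnorm_aeeq (PL2 (measurableI _ _ mA' mA) fL) (PL2 mA' (PL2 mA fL))
  (P_I mA' mA fL)).
Qed.

Let P_orth A A' f g : measurable A -> measurable A' -> A `&` A' = set0 ->
  L2 f -> L2 g -> inner (P A f) (P A' g) = 0.
Proof.
move=> mA mA' AA' fL gL; have gL' := PL2 mA' gL.
rewrite (P_sym mA fL gL') (inner_aeeqr fL (PL2 mA gL') L2_0) ?inner0r//.
apply: aeeq_trans (P_set0 gL); rewrite -AA'; apply: aeeq_sym.
exact: P_I.
Qed.

Let sqnorm_P A f : measurable A -> L2 f ->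
  inner f (P A f) = (fine (sqnorm setT (P A f)))%:C%C.
Proof.
move=> mA fL; have hL := PL2 mA fL.
rewrite -(inner_ff hL) (P_sym mA fL hL).
exact: (inner_aeeqr fL hL (PL2 mA hL) (aeeq_sym (P_idem mA fL))).
Qed.

(** Additivity in [A] is available through the spectral mass of [f], which is a measure: it gives
    [|f|^2 = |P_A f|^2]. Since [<f, P_A f> = |P_A f|^2], expanding [|f - P_A f|^2] leaves 0. *)
Let P_full A f : measurable A -> L2 f -> sqnorm setT (P (~` A) f) = 0%E ->
  aeeq (P A f) f.
Proof.
move=> mA fL PC0; have PAL := PL2 mA fL; have mAC := measurableC mA.
have [m [mE _ _]] := mass fL.
have sqE : sqnorm setT f = sqnorm setT (P A f).
  rewrite -(sqnorm_aeeq (PL2 measurableT fL) fL (P_T fL)).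
  rewrite -(mE _ measurableT) -(mE _ mA) -(setUv A) measureU ?setICr//.
  by rewrite [X in (_ + X)%E](mE _ mAC) PC0 adde0.
have := sqnorm_lin (-1) PAL fL; rewrite sqE mulN1r (sqnorm_P mA fL)/=.
rewrite (_ : sqmod (-1) = 1); last by rewrite /sqmod /=; ring.
rewrite (_ : _ + _ + _ = 0); last by ring.
move=> /(sqnorm_eq0 (L2_lin _ PAL fL)).
apply: area_aeS => x; rewrite mulN1r addrC => /eqP; rewrite subr_eq0.
by move=> /eqP ->.
Qed.

(** The spectral mass of [P A f] is finite and carried by the bounded set [A], so its second moment
    is finite, which is the criterion for the domain. *)
Let dom_bounded (A : set mR) f (r : R) : measurable A -> L2 f ->
    (forall t : R, A t -> `|t| <= r) ->
  exists g, H (P A f) g.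
Proof.
move=> mA fL Ar; have [m [mE Hm _]] := mass (PL2 mA fL).
have mT : (m setT < +oo)%E.
  rewrite (mE _ measurableT) ltey_eq sqnorm_fin_num//.
  exact: (PL2 measurableT (PL2 mA fL)).
apply/Hm; apply: (integral_sqr_lty mA _ mT Ar).
have mAC := measurableC mA.
rewrite (mE _ mAC) (mass_comp mA mAC fL) setICl.
have [m' [m'E _ _]] := mass fL.
by rewrite -(m'E _ measurable0) measure0.
Qed.

Let inner_P A A' f f' D : measurable A -> measurable A' ->
  measurable D -> A `&` A' = set0 -> L2 f -> L2 f' ->
  inner (P D (P A f)) (P D (P A' f')) = 0.
Proof.
move=> mA mA' mD AA' fL f'L.
have hL := PL2 mA fL; have kL := PL2 mA' f'L.
have DA X g : measurable X -> L2 g -> aeeq (P D (P X g)) (P (D `&` X) g).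
  by move=> mX gL; apply: aeeq_sym; exact: P_I.
rewrite (inner_aeeql (PL2 mD kL) (PL2 mD hL) _ (DA A f mA fL)); last first.
  by apply: PL2 fL; exact: measurableI.
have mDA := measurableI _ _ mD mA; have mDA' := measurableI _ _ mD mA'.
rewrite (inner_aeeqr (PL2 mDA fL) (PL2 mD kL) (PL2 mDA' f'L) (DA A' f' mA' f'L)).
by apply: P_orth => //; rewrite setIACA AA' setI0.
Qed.

(** Pythagoras: [P D] keeps the two vectors orthogonal, so [c] enters only through its modulus. *)
Let mass_lin_phase A A' f f' (c : R[i]) D : measurable A -> measurable A' ->
  measurable D -> A `&` A' = set0 -> L2 f -> L2 f' -> sqmod c = 1 ->
  sqnorm setT (P D (fun x => c * P A f x + P A' f' x)) =
  (sqnorm setT (P D (P A f)) + sqnorm setT (P D (P A' f')))%E.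
Proof.
move=> mA mA' mD AA' fL f'L c1.
have hL := PL2 mA fL; have kL := PL2 mA' f'L.
rewrite (sqnorm_aeeq (PL2 mD (L2_lin c hL kL))
  (L2_lin c (PL2 mD hL) (PL2 mD kL)) (P_lin c mD hL kL)).
rewrite (sqnorm_lin c (PL2 mD hL) (PL2 mD kL)).
rewrite c1 mul1r (inner_P mA' mA mD _ f'L fL); last by rewrite setIC.
rewrite mulr0/= mulr0 addr0 EFinD !fineK//; apply: sqnorm_fin_num.
  exact: (PL2 mD kL).
exact: (PL2 mD hL).
Qed.

(* Replacing [h] by [c h] with [|c| = 1] does not change the spectral mass of
   [h + k], hence not the quadratic form of [H] at it; so the cross terms of
   this form vanish. *)
Let graph_orth A A' f f' g g' : measurable A -> measurable A' ->
  A `&` A' = set0 -> L2 f -> L2 f' -> H (P A f) g -> H (P A' f') g' ->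
  inner (P A' f') g = 0.
Proof.
move=> mA mA' AA' fL f'L Hg Hg'.
set h := P A f in Hg *; set k := P A' f' in Hg' *.
have [hL gL] := HL2 Hg; have [kL g'L] := HL2 Hg'.
pose q c := inner (fun x => c * h x + k x) (fun x => c * g x + g' x).
have qE c : sqmod c = 1 -> q c = q 1.
  move=> c1; have [m [mE _ /(_ _ (Hlin c Hg Hg'))]] := mass (L2_lin c hL kL).
  have [m' [m'E _ /(_ _ (Hlin 1 Hg Hg'))]] := mass (L2_lin 1 hL kL).
  rewrite /q => -> ->; congr (_%:C%C); congr fine.
  apply: eq_measure_integral => D mD _.
  transitivity (sqnorm setT (P D (fun x => c * h x + k x))); first exact: mE.
  transitivity (sqnorm setT (P D (fun x => 1 * h x + k x))); last exact/esym/m'E.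
  rewrite (mass_lin_phase mA mA' mD AA' fL f'L c1).
  rewrite (mass_lin_phase mA mA' mD AA' fL f'L)//.
  by rewrite /sqmod /=; ring.
have qX c : q c = conjc c * c * inner h g + conjc c * inner h g' +
    c * inner k g + inner k g'.
  rewrite /q (inner_linr c (L2_lin c hL kL) gL g'L).
  by rewrite (inner_linl c gL hL kL) (inner_linl c g'L hL kL); ring.
(* Put [X = <h, g'>] and [Y = <k, g>]. The phase -1 gives [X + Y = 0], and the phase [i] gives
   [- i X + i Y = X + Y], so [X = Y = 0]. *)
have q1 := qE (-1) ltac:(rewrite /sqmod /=; ring).
have q2 := qE 'i%C ltac:(rewrite /sqmod /=; ring).
move: q1 q2; rewrite !qX.
case: (inner h g) (inner h g') (inner k g) (inner k g')
  => ? ? [? ?] [? ?] [? ?] /eqP; rewrite eq_complex/= => /andP[/eqP ? /eqP ?].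
move=> /eqP; rewrite eq_complex/= => /andP[/eqP ? /eqP ?].
by apply/eqP; rewrite eq_complex/=; apply/andP; split; apply/eqP; lra.
Qed.

(** It suffices that [g] has no spectral mass off [A]. For a bounded piece [D] of the complement,
    [P D g] is in the domain, so [graph_orth] makes it orthogonal to [g], that is, [|P D g|^2 = 0].
    The boundedness of the pieces is what gives the domain, and countably many of them exhaust the
    complement. *)
Let P_graph A f g : measurable A -> L2 f -> H (P A f) g -> aeeq (P A g) g.
Proof.
move=> mA fL Hg; have [hL gL] := HL2 Hg.
apply: (P_full mA gL); have [m [mE _ _]] := mass gL.
have mAC : measurable (~` A) := measurableC mA.
rewrite -(mE _ mAC); pose I n : set mR := `[- n%:R, n%:R]%classic.
have mI n : measurable (I n) by exact: measurable_itv.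
have -> : ~` A = \bigcup_n (~` A `&` I n).
  rewrite -setI_bigcupr (_ : \bigcup_n _ = setT) ?setIT//.
  apply/seteqP; split => // t _; exists (Num.truncn `|t|).+1 => //.
  by rewrite /I /= in_itv/= -ler_norml ltW// truncnS_gt.
apply/negligibleP; first by apply: bigcupT_measurable => n; exact: measurableI.
apply: negligible_bigcup => n; apply/negligibleP; first exact: measurableI.
have mD : measurable (~` A `&` I n) by exact: measurableI.
have [g' Hg'] : exists g', H (P (~` A `&` I n) g) g'.
  apply: (dom_bounded (r := n%:R) mD gL) => t [_].
  by rewrite /I /= in_itv/= -ler_norml.
have := graph_orth mA mD _ fL gL Hg Hg'.
rewrite setIA setICr set0I => /(_ erefl) /(congr1 conjc).
rewrite -(innerC (PL2 mD gL) gL) (sqnorm_P mD gL) conjc0 => /(congr1 re)/= g0.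
by rewrite (mE _ mD) -(fineK (sqnorm_fin_num (PL2 mD gL))) g0.
Qed.

Lemma weak_eigenvector_spectral (b E : R) (f : cfun) : b <= E -> L2 f ->
  (forall h g, H h g -> inner f g = b%:C%C * inner f h) ->
  aeeq f (P `]-oo, E] f).
Proof.
move=> bE fL fw.
have mO : measurable (`]-oo, E]%classic : set mR) by exact: measurable_itv.
apply: aeeq_sym; apply: (P_full mO fL); have [m [mE _ _]] := mass fL.
rewrite -(mE _ (measurableC mO)).
(* The half-line above [E] is exhausted by closed bounded intervals, each lying strictly above [b]:
   boundedness puts [P A f] in the domain, and the gap above [b] makes [null_of_mean] applicable. *)
pose a n : R := E + n.+1%:R^-1.
pose I n : set mR := `[a n, n%:R]%classic.
have mI n : measurable (I n) by exact: measurable_itv.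
have -> : ~` (`]-oo, E]%classic : set mR) = \bigcup_n I n.
  apply/seteqP; split => t /=.
    rewrite in_itv/= => /negP; rewrite -ltNge => Et.
    (* The first entry ensures [t <= n], the second [1 / (n + 1) <= t - E]. *)
    pose n := maxn (Num.truncn `|t|).+1 (Num.truncn (t - E)^-1).
    have tn : t <= n%:R.
      apply: le_trans (ler_norm _) _; apply: ltW; apply: lt_le_trans (truncnS_gt _) _.
      by rewrite ler_nat leq_maxl.
    exists n => //; rewrite /I /a /= in_itv/= tn andbT -lerBrDl.
    rewrite -[leRHS]invrK lef_pV2 ?posrE ?invr_gt0 ?subr_gt0//.
    apply: ltW; apply: lt_le_trans (truncnS_gt _) _.
    by rewrite ler_nat ltnS leq_maxr.
  move=> [n _]; rewrite /I /a /= !in_itv/= => /andP[ant _].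
  apply/negP; rewrite -ltNge; apply: lt_le_trans ant.
  by rewrite ltrDl invr_gt0.
apply/negligibleP; first by apply: bigcupT_measurable => n.
apply: negligible_bigcup => n; apply/negligibleP => //.
set A := I n; have mA : measurable A := mI n.
have hL := PL2 mA fL.
have [g Hg] : exists g, H (P A f) g.
  apply: (dom_bounded (r := `|a n| + n%:R) mA fL) => t.
  rewrite /A /I /= in_itv/= => /andP[h1 h2].
  have := ler_norm (- a n); rewrite normrN; have := normr_ge0 (a n).
  have : (0 : R) <= n%:R by [].
  by rewrite ler_norml; lra.
have gL := (HL2 Hg).2.
have [mh [mhE _ /(_ _ Hg)]] := mass hL.
(* The first moment of [mh] is [<P A f, g> = <f, P A g> = <f, g> = b <f, P A f> = b |P A f|^2]. *)
rewrite (P_sym mA fL gL) (inner_aeeqr fL (PL2 mA gL) gL (P_graph mA fL Hg)) (fw _ _ Hg).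
rewrite (sqnorm_P mA fL) => /(congr1 re)/=; rewrite mul0r subr0 => meanE.
have mhT : mh setT = sqnorm setT (P A f).
  rewrite (mhE _ measurableT).
  exact: (sqnorm_aeeq (PL2 measurableT hL) hL (P_T hL)).
rewrite (mE _ mA) -mhT; apply: (@null_of_mean mh (a n) n%:R b).
- have mAC := measurableC mA.
  rewrite (mhE _ mAC) (mass_comp mA mAC fL) setICl; have [m' [m'E _ _]] := mass fL.
  by rewrite -(m'E _ measurable0) measure0.
- by rewrite mhT ltey_eq (sqnorm_fin_num hL).
- by apply: le_lt_trans bE _; rewrite ltrDl invr_gt0.
- by rewrite -meanE mhT.
Qed.

End Spectral.

(** * Translated ground states *)

Section Gaussian.
Context {R : realType}.

Local Notation borel2 := (measurableTypeR R * measurableTypeR R)%type.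
Local Notation cfun := (R * R -> R[i]).
Local Notation re := (@complex.Re R).
Local Notation im := (@complex.Im R).
Local Notation leb := (@lebesgue_measure R).

Lemma integral_gaussian_line (c : R) : 0 < c -> exists2 K : R, 0 < K &
  forall m : R, (\int[leb]_t (expR (- c * (t - m) ^+ 2))%:E = K%:E)%E.
Proof.
(* Standard deviation of the normal law with exponent [- c (t - m)^2], from [1 / (2 s^2) = c]. *)
move=> c0; pose s := (Num.sqrt (2 * c))^-1.
have s0 : s != 0 by rewrite gt_eqF// invr_gt0 sqrtr_gt0 mulr_gt0.
have sE : (s ^+ 2 *+ 2)^-1 = c.
  rewrite /s exprVn sqr_sqrtr; last by rewrite mulr_ge0// ltW.
  by rewrite -mulr_natr invfM invrK mulrAC divff ?mul1r// pnatr_eq0.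
have p0 := normal_peak_gt0 s0; exists (normal_peak s)^-1; first by rewrite invr_gt0.
move=> m; transitivity (\int[leb]_t ((normal_peak s)^-1%:E *
    (normal_pdf m s t)%:E))%E.
  apply: eq_integral => t _; rewrite normal_pdfE// /normal_fun sE -EFinM mulKf ?gt_eqF//.
  by rewrite mulNr [c * _]mulrC mulNr.
by rewrite integralZl ?integral_normal_pdf ?mule1//; exact: integrable_normal_pdf.
Qed.

Definition sqdist (a x : R * R) : R := (x.1 - a.1) ^+ 2 + (x.2 - a.2) ^+ 2.

Lemma Ck_sqdist k a : Ck k (sqdist a).
Proof.
apply: CkD.
  apply: Ck_eq (CkM (CkD (Ck_fst k) (Ck_cst k (- a.1))) (CkD (Ck_fst k) (Ck_cst k (- a.1)))).
  by move=> x; rewrite expr2.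
apply: Ck_eq (CkM (CkD (Ck_snd k) (Ck_cst k (- a.2))) (CkD (Ck_snd k) (Ck_cst k (- a.2)))).
by move=> x; rewrite expr2.
Qed.

Lemma Ck_gaussian k c a : Ck k (fun x : R * R => expR (- c * sqdist a x)).
Proof. by apply: Ck_expR; apply: CkZ; exact: Ck_sqdist. Qed.

Lemma measurable_gaussian c a :
  measurable_fun [set: borel2] (fun x : borel2 => (expR (- c * sqdist a x))%:E).
Proof.
apply/measurable_EFinP; apply: continuous_measurable_prod.
exact: (Ck_gaussian 0).
Qed.

(** The Gaussian is a product of two one-dimensional ones, and Tonelli applies. That [K] is chosen
    before the centre [a] is the source of the uniformity in thickness. *)
Lemma integral_gaussian_plane (c : R) : 0 < c -> exists2 K : R, 0 < K &
  forall a : R * R, (\int[area]_x (expR (- c * sqdist a x))%:E = K%:E)%E.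
Proof.
move=> c0; have [K K0 KE] := integral_gaussian_line c0.
exists (K * K); first exact: mulr_gt0.
move=> a; have mg := measurable_gaussian c a.
have g0 (x : borel2) : (0 <= (expR (- c * sqdist a x))%:E)%E.
  by rewrite lee_fin expR_ge0.
rewrite (ge0_integral_area mg g0) (fubini_tonelli1 _ mg g0) /fubini_F.
have m1 m : measurable_fun [set: R] (fun t : R => (expR (- c * (t - m) ^+ 2))%:E).
  apply/measurable_EFinP; apply: measurableT_comp => //.
  by apply: measurable_funM => //; apply: measurable_funX; exact: measurable_funB.
have e0 (m t : R) : (0 <= (expR (- c * (t - m) ^+ 2))%:E)%E by rewrite lee_fin expR_ge0.
have Z (k m : R) : 0 <= k ->
    (\int[leb]_t (k%:E * (expR (- c * (t - m) ^+ 2))%:E) = k%:E * K%:E)%E.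
  move=> k0; rewrite -(KE m).
  exact: (ge0_integralZl_EFin leb measurableT (fun t _ => e0 m t) (m1 m) k0).
transitivity (\int[leb]_s (K%:E * (expR (- c * (s - a.1) ^+ 2))%:E))%E.
  apply: eq_integral => s _; rewrite muleC -(Z _ a.2 (expR_ge0 _)).
  by apply: eq_integral => t _; rewrite -EFinM -expRD /sqdist mulrDr.
by rewrite (Z _ _ (ltW K0)).
Qed.

Section GroundState.
Context (B : R) (a : R * R).

(** Translation by [a] changes the magnetic potential by a constant; the gradient of this linear
    phase compensates it. *)
Let phase (x : R * R) : R := B / 2 * (x.2 * a.1 - x.1 * a.2).
Let gauss (x : R * R) : R := expR (- (B / 4) * sqdist a x).

(* The magnetic translate to a of the lowest Landau level exp(-B|x|^2/4). *)
Definition ground_state : cfun := fun x =>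
  (gauss x * cos (phase x) +i* (gauss x * sin (phase x)))%C.

Let Ck_phase k : Ck k phase.
Proof.
by apply: CkZ; apply: CkD; [|apply: CkN]; apply: CkM;
  do ?[exact: Ck_fst|exact: Ck_snd|exact: Ck_cst].
Qed.

Lemma cCk_ground_state k : cCk k ground_state.
Proof.
split; apply: CkM; try exact: Ck_gaussian.
  exact: Ck_cos.
exact: Ck_sin.
Qed.

Lemma sqmod_ground_state x : sqmod (ground_state x) = expR (- (B / 2) * sqdist a x).
Proof.
rewrite /sqmod /= !exprMn -mulrDr cos2Dsin2 mulr1 /gauss -expRM_natl.
by congr expR; rewrite -mulr_natl; field.
Qed.

Lemma L2_ground_state : 0 < B -> L2 ground_state.
Proof.
move=> B0; have B2 : 0 < B / 2 by rewrite divr_gt0.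
have [K _ KE] := integral_gaussian_plane B2.
have [Cr Ci] := cCk_ground_state 0.
apply/L2P; split.
- by apply: measurable_fun_plane; exact: continuous_measurable_prod.
- by apply: measurable_fun_plane; exact: continuous_measurable_prod.
- apply: (@le_lt_trans _ _ K%:E); last by rewrite ltry.
  rewrite -(KE a) le_eqVlt; apply/orP; left; apply/eqP.
  by apply: eq_integral => x _; rewrite sqmod_ground_state.
Qed.

Let derive_phase v x : 'D_v phase x = B / 2 * (v.2 * a.1 - v.1 * a.2).
Proof.
have C1 := Ck_derivable (k := 0).
have Cc := Ck_cst 1; have Cf := Ck_fst 1; have Cs := Ck_snd 1.
have Ca (c d : R) : Ck 1 (fun x : R * R => x.2 * c - x.1 * d).
  by apply: CkD; [exact: CkM|apply: CkN; exact: CkM].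
rewrite derive_mul; [|exact: C1|exact: C1].
rewrite derive_cst mulr0 addr0 derive_sub; [|apply: C1; exact: CkM|apply: C1; exact: CkM].
rewrite !derive_mul; try exact: C1.
by rewrite !derive_cst derive_fst derive_snd !mulr0 !add0r; ring.
Qed.

Let derive_sqdist v x : 'D_v (sqdist a) x =
  2 * (x.1 - a.1) * v.1 + 2 * (x.2 - a.2) * v.2.
Proof.
have C1 := Ck_derivable (k := 0).
have Cc := Ck_cst 1; have Cf := Ck_fst 1; have Cs := Ck_snd 1.
have -> : sqdist a = fun x => (x.1 - a.1) * (x.1 - a.1) + (x.2 - a.2) * (x.2 - a.2).
  by apply/funext => y; rewrite /sqdist !expr2.
have C1a : Ck 1 (fun x : R * R => x.1 - a.1) by apply: CkD.
have C2a : Ck 1 (fun x : R * R => x.2 - a.2) by apply: CkD.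
rewrite derive_add; [|apply: C1; exact: CkM|apply: C1; exact: CkM].
rewrite !derive_mul; try exact: C1.
rewrite !derive_sub; try exact: C1.
by rewrite !derive_cst derive_fst derive_snd; ring.
Qed.

Let derive_gauss v x : 'D_v gauss x =
  - (B / 2) * ((x.1 - a.1) * v.1 + (x.2 - a.2) * v.2) * gauss x.
Proof.
have Csq := Ck_sqdist 1 a.
rewrite (derive_comp1 (g := @expR R) (dg := gauss x)) /=.
- have C1 := Ck_derivable (k := 0); have Cc := Ck_cst 1.
  rewrite derive_mul; [|exact: C1|exact: C1].
  by rewrite derive_cst derive_sqdist; field.
- by have [+ _] := CkZ (- (B / 4)) Csq; exact.
Qed.

Let derive_re v x : 'D_v (re \o ground_state) x =
  - (B / 2) * ((x.1 - a.1) * v.1 + (x.2 - a.2) * v.2) * re (ground_state x)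
  - B / 2 * (v.2 * a.1 - v.1 * a.2) * im (ground_state x).
Proof.
have Cg : Ck 1 gauss := Ck_gaussian 1 _ _.
have Cp := Ck_phase 1.
rewrite derive_mul; [|exact: Ck_derivable Cg|exact: Ck_derivable (Ck_cos Cp)].
rewrite derive_gauss (derive_comp1 (g := @cos R) (dg := - sin (phase x))).
- by rewrite derive_phase /=; ring.
- exact: Cp.1.
Qed.

Let derive_im v x : 'D_v (im \o ground_state) x =
  - (B / 2) * ((x.1 - a.1) * v.1 + (x.2 - a.2) * v.2) * im (ground_state x)
  + B / 2 * (v.2 * a.1 - v.1 * a.2) * re (ground_state x).
Proof.
have Cg : Ck 1 gauss := Ck_gaussian 1 _ _.
have Cp := Ck_phase 1.
rewrite derive_mul; [|exact: Ck_derivable Cg|exact: Ck_derivable (Ck_sin Cp)].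
rewrite derive_gauss (derive_comp1 (g := @sin R) (dg := cos (phase x))).
- by rewrite derive_phase /=; ring.
- exact: Cp.1.
Qed.

(** On the ground state the two magnetic derivatives act as multiplication by the affine functions
    [eta] and [zeta]. The relation [zeta = i eta] says that the first derivative plus [i] times the
    second annihilates it, as in the lowest Landau level. *)
Let aff (c d : R[i]) (x : R * R) : R[i] :=
  c * (x.1 - a.1)%:C%C + d * (x.2 - a.2)%:C%C.
Let eta := aff (0 +i* - (B / 2))%C (- (B / 2) +i* 0)%C.
Let zeta := aff (B / 2 +i* 0)%C (0 +i* - (B / 2))%C.

Let magnetic1_ground_state :
  magnetic1 B ground_state = fun x => eta x * ground_state x.
Proof.
apply/funext => x; rewrite /magnetic1 /cpartial derive_re derive_im.
case: (ground_state x) => s t.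
by apply/eqP; rewrite eq_complex /=; apply/andP; split; apply/eqP; field.
Qed.

Let magnetic2_ground_state :
  magnetic2 B ground_state = fun x => zeta x * ground_state x.
Proof.
apply/funext => x; rewrite /magnetic2 /cpartial derive_re derive_im.
case: (ground_state x) => s t.
by apply/eqP; rewrite eq_complex /=; apply/andP; split; apply/eqP; field.
Qed.

Let cpartial_mul v (f g : cfun) x : cCk 1 f -> cCk 1 g ->
  cpartial v (fun y => f y * g y) x = cpartial v f x * g x + f x * cpartial v g x.
Proof.
move=> [fr fi] [gr gi]; rewrite /cpartial.
have C1 := Ck_derivable (k := 0).
have -> : re \o (fun y => f y * g y) =
    fun y => (re \o f) y * (re \o g) y - (im \o f) y * (im \o g) y.
  by apply/funext => y /=; case: (f y) (g y) => ? ? [? ?].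
have -> : im \o (fun y => f y * g y) =
    fun y => (re \o f) y * (im \o g) y + (im \o f) y * (re \o g) y.
  by apply/funext => y /=; case: (f y) (g y) => ? ? [? ?].
rewrite derive_sub; [|exact: C1 (CkM fr gr)|exact: C1 (CkM fi gi)].
rewrite derive_add; [|exact: C1 (CkM fr gi)|exact: C1 (CkM fi gr)].
rewrite (derive_mul (C1 _ _ v x fr) (C1 _ _ v x gr)).
rewrite (derive_mul (C1 _ _ v x fi) (C1 _ _ v x gi)).
rewrite (derive_mul (C1 _ _ v x fr) (C1 _ _ v x gi)).
rewrite (derive_mul (C1 _ _ v x fi) (C1 _ _ v x gr)).
rewrite /=; case: (f x) (g x) => ? ? [? ?].
by apply/eqP; rewrite eq_complex /=; apply/andP; split; apply/eqP; ring.
Qed.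

Let aff_parts c d : re \o aff c d =
    (fun x => re c * (x.1 - a.1) + re d * (x.2 - a.2)) /\
  im \o aff c d = (fun x => im c * (x.1 - a.1) + im d * (x.2 - a.2)).
Proof.
by split; apply/funext => x; case: c d => ? ? [? ?] /=; ring.
Qed.

Let Ck_affine (r s : R) k :
  Ck k (fun x : R * R => r * (x.1 - a.1) + s * (x.2 - a.2)).
Proof.
apply: CkD; apply: CkZ; apply: CkD;
  by do ?[exact: Ck_fst|exact: Ck_snd|exact: Ck_cst].
Qed.

Let derive_affine (r s : R) v x :
  'D_v (fun x : R * R => r * (x.1 - a.1) + s * (x.2 - a.2)) x = r * v.1 + s * v.2.
Proof.
have C1 := Ck_derivable (k := 0).
have Cc := Ck_cst 1; have Cf := Ck_fst 1; have Cs := Ck_snd 1.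
have C1a : Ck 1 (fun x : R * R => x.1 - a.1) by apply: CkD.
have C2a : Ck 1 (fun x : R * R => x.2 - a.2) by apply: CkD.
rewrite derive_add; [|exact: C1 (CkZ r C1a)|exact: C1 (CkZ s C2a)].
rewrite !derive_mul; try exact: C1.
rewrite !derive_sub; try exact: C1.
by rewrite !derive_cst derive_fst derive_snd; ring.
Qed.

Let cCk_aff c d k : cCk k (aff c d).
Proof. by have [er ei] := aff_parts c d; split; rewrite ?er ?ei; exact: Ck_affine. Qed.

Let cpartial_aff c d v x : cpartial v (aff c d) x = c * v.1%:C%C + d * v.2%:C%C.
Proof.
have [er ei] := aff_parts c d; rewrite /cpartial er ei !derive_affine.
case: c d {er ei} => ? ? [? ?].
by apply/eqP; rewrite eq_complex /=; apply/andP; split; apply/eqP; ring.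
Qed.

(** Applying each magnetic derivative twice gives the factor [eta^2 + zeta^2], which is 0 as
    [zeta = i eta], plus [i] times the sum of the first partial derivative of [eta] and the second
    of [zeta]. Both equal [- i B / 2], so the eigenvalue is [B]. *)
Lemma landau_ground_state x :
  landau_expr B ground_state x = B%:C%C * ground_state x.
Proof.
have Cg := cCk_ground_state 1.
have m1 : magnetic1 B (fun x => eta x * ground_state x) x =
    eta x * magnetic1 B ground_state x + 'i%C * cpartial (1, 0) eta x * ground_state x.
  rewrite /magnetic1 (cpartial_mul _ _ (cCk_aff _ _ 1 : cCk 1 eta) Cg).
  move: (cpartial _ _ _) (cpartial _ _ _) (eta x) (ground_state x) (_%:C%C).
  by move=> *; ring.
have m2 : magnetic2 B (fun x => zeta x * ground_state x) x =
    zeta x * magnetic2 B ground_state x + 'i%C * cpartial (0, 1) zeta x * ground_state x.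
  rewrite /magnetic2 (cpartial_mul _ _ (cCk_aff _ _ 1 : cCk 1 zeta) Cg).
  move: (cpartial _ _ _) (cpartial _ _ _) (zeta x) (ground_state x) (_%:C%C).
  by move=> *; ring.
rewrite /landau_expr magnetic1_ground_state magnetic2_ground_state m1 m2.
rewrite magnetic1_ground_state magnetic2_ground_state !cpartial_aff /eta /zeta /aff.
case: (ground_state x) => s t.
by apply/eqP; rewrite eq_complex /=; apply/andP; split; apply/eqP; field.
Qed.

End GroundState.
End Gaussian.

(** * Thickness *)

Lemma ground_state_spectral_range (R : realType) (B E : R) (a : R * R) :
  0 < B -> B <= E -> spectral_range (landau B) `]-oo, E] (ground_state B a).
Proof.
move=> B0 BE; have fL := L2_ground_state a B0; split=> // P PH.
exists (ground_state B a) => //.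
apply: (weak_eigenvector_spectral _ _ PH BE fL).
- by move=> f u [fL' uL _].
- by move=> c f g u v; exact: landau_lin.
- exact: (landau_weak fL (cCk_ground_state B a 2) (landau_ground_state B a)).
Qed.

(** The Gaussian is centred in the square [Q] of side [2 r]. On [Q] it is at most 1. Off [Q] some
    coordinate is further than [r] from the centre, so half of the exponent yields the factor
    [exp(- B r^2 / 4)], and the other half is kept as an integrable Gaussian. *)
Lemma sqnorm_ground_state_le (R : realType) (B : R) (a l : R * R)
    (S : set (plane R)) (r : R) : 0 < B -> measurable S -> 0 <= r ->
  l = (2 * r, 2 * r) ->
  (sqnorm S (ground_state B (a.1 + r, a.2 + r)%R) <=
   area (S `&` rectangle a l) + (expR (- (B / 4) * r ^+ 2))%:E *
     \int[area]_x (expR (- (B / 4) * sqdist (a.1 + r, a.2 + r)%R x))%:E)%E.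
Proof.
move=> B0 mS r0 ->; set c := (_ + _, _ + _); set Q := rectangle _ _.
have mQ : measurable Q := measurable_rectangle _ _.
pose g x : \bar R := (expR (- (B / 4) * sqdist c x))%:E.
have mg : measurable_fun [set: plane R] g.
  by apply: measurable_fun_plane; exact: measurable_gaussian.
have g0 x : (0 <= g x)%E by rewrite lee_fin expR_ge0.
pose e : R := expR (- (B / 4) * r ^+ 2).
have mQ1 : measurable_fun S (fun x : plane R => (\1_Q x)%:E : \bar R).
  by apply: measurable_funTS; apply/measurable_EFinP; exact: measurable_indic.
have meg : measurable_fun S (fun x => e%:E * g x)%E.
  by apply: measurable_funTS; exact: measurable_funeM.
have eg0 x : (0 <= e%:E * g x)%E by rewrite mule_ge0// lee_fin expR_ge0.
apply: (@le_trans _ _ (\int[area]_(x in S) ((\1_Q x)%:E + e%:E * g x))%E).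
  apply: (ge0_le_integral area mS) => [x _| | |x _].
  - by rewrite lee_fin sqmod_ge0.
  - apply: measurable_funTS.
    exact: (measurable_sqmod (L2_ground_state c B0)).
  - exact: emeasurable_funD.
  rewrite sqmod_ground_state; have [xQ|xQ] := boolP (x \in Q).
    rewrite indicE xQ -[leLHS]adde0; apply: leeD => //.
    rewrite lee_fin -expR0 ler_expR mulNr oppr_le0 mulr_ge0//.
      by rewrite divr_ge0// ltW.
    by rewrite addr_ge0// sqr_ge0.
  rewrite indicE (negbTE xQ) add0e -EFinM lee_fin -expRD ler_expR.
  have far : r ^+ 2 <= sqdist c x.
    move: xQ; rewrite notin_setE /Q /rectangle /= !in_itv/= => xQ.
    have far1 (u m : R) : ~~ (m <= u <= m + 2 * r) -> r ^+ 2 <= (u - (m + r)) ^+ 2.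
      by rewrite negb_and -!ltNge => /orP[h|h]; nra.
    have [h1|h1] := boolP (a.1 <= x.1 <= a.1 + 2 * r).
      have /far1 h2 : ~~ (a.2 <= x.2 <= a.2 + 2 * r) by apply/negP => h2; exact: xQ.
      by apply: le_trans h2 _; rewrite lerDr sqr_ge0.
    by apply: le_trans (far1 _ _ h1) _; rewrite lerDl sqr_ge0.
  by nra.
rewrite (ge0_integralD area mS)//.
apply: leeD; first by rewrite integral_indic// setIC.
apply: (@le_trans _ _ (\int[area]_x (e%:E * g x))%E).
  exact: (@ge0_subset_integral _ _ _ area S setT mS measurableT _
    (measurable_funeM e%:E mg) (fun x _ => eg0 x) (@subsetT _ S)).
by rewrite (ge0_integralZl_EFin area measurableT)//; exact: expR_ge0.
Qed.

Theorem theorem12 (R : realType) (S : set (plane R)) (mS : measurable S)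
  (hS : exists B : R, 0 < B /\ exists E : R, B <= E /\
    exists C : R, 0 < C /\
      forall f : R * R -> R[i],
        spectral_range (landau B) `]-oo, E] f ->
        (sqnorm setT f <= C%:E * sqnorm S f)%E) :
  thick S.
Proof.
have [B [B0 [E [BE [C [C0 hC]]]]]] := hS.
have B2 : 0 < B / 2 by rewrite divr_gt0.
have B4 : 0 < B / 4 by rewrite divr_gt0.
have [K1 K10 K1E] := integral_gaussian_plane B2.
have [K2 K20 K2E] := integral_gaussian_plane B4.
(* With this bound on the tail factor, [C d K2 = K1 / 2]: the tail accounts for at most half of the
   total mass [K1]. *)
pose d := K1 / (2 * C * K2).
have d0 : 0 < d by rewrite divr_gt0// !mulr_gt0.
(* As [r > 1], also [r^2 >= (B d / 4)^-1], that is, [B r^2 / 4 >= 1 / d]; then [exp y >= 1 + y]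
   bounds the tail factor by [d]. *)
pose r := 1 + (B / 4 * d)^-1.
have r1 : 1 < r by rewrite ltrDl invr_gt0 mulr_gt0.
have r0 : 0 < r by exact: lt_trans r1.
have ed : expR (- (B / 4) * r ^+ 2) <= d.
  have dE : B / 4 * r ^+ 2 >= d^-1.
    have -> : d^-1 = B / 4 * (B / 4 * d)^-1.
      by rewrite (invfM (B / 4) d) mulVKf// gt_eqF.
    rewrite ler_pM2l//; have : 0 < (B / 4 * d)^-1 by rewrite invr_gt0 mulr_gt0.
    by rewrite /r; nra.
  rewrite mulNr expRN -[leRHS]invrK lef_pV2 ?posrE ?invr_gt0 ?expR_gt0//.
  by apply: le_trans dE _; apply: le_trans (expR_ge1Dx _); rewrite lerDr.
pose l : R * R := (2 * r, 2 * r).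
(* The remaining half of the mass gives area at least [K1 / (2 C)] in a square of area [4 r^2]; the
   minimum ensures [rho <= 1]. *)
pose rho := Num.min 1 (K1 / (2 * C) / (4 * r ^+ 2)).
exists l, rho; split; rewrite ?mulr_gt0//.
  rewrite lt_min ltr01 ge_min lexx andbT.
  by rewrite !divr_gt0// mulr_gt0// exprn_gt0.
move=> a; rewrite area_rectangle ?mulr_gt0// -EFinM.
(* [rectangle a l] has its lower left corner at [a], so its centre is [a + (r, r)]. *)
have := hC _ (ground_state_spectral_range (a.1 + r, a.2 + r) B0 BE).
have -> : sqnorm setT (ground_state B (a.1 + r, a.2 + r)) = K1%:E.
  by rewrite -(K1E (a.1 + r, a.2 + r)); apply: eq_integral => x _;
    rewrite sqmod_ground_state.
have := @sqnorm_ground_state_le R B a l S r B0 mS (ltW r0) erefl.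
have mQ : measurable (rectangle a l : set (plane R)) := measurable_rectangle _ _.
have fin : area (S `&` rectangle a l) \is a fin_num.
  rewrite ge0_fin_numE//; apply: (@le_lt_trans _ _ (area (rectangle a l))).
    apply: le_measure; rewrite ?inE; last exact: subIsetr.
      exact: measurableI mS mQ.
    exact: mQ.
  by rewrite area_rectangle ?mulr_gt0// ltry.
rewrite -(fineK fin); move: (fine _) => m; rewrite K2E => le1 le2.
have : (K1%:E <= C%:E * (m%:E + (expR (- (B / 4) * r ^+ 2))%:E * K2%:E))%E.
  by apply: le_trans le2 _; apply: lee_wpmul2l => //; rewrite lee_fin ltW.
rewrite -!EFinM !lee_fin => K1le.
have mK : K1 / (2 * C) <= m.
  rewrite ler_pdivrMr ?mulr_gt0//.
  have : C * (d * K2) = K1 / 2 by rewrite /d; field; rewrite !gt_eqF.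
  have : C * (expR (- (B / 4) * r ^+ 2) * K2) <= C * (d * K2).
    by rewrite ler_pM2l// ler_pM2r.
  by move: K1le; rewrite mulrDr; lra.
apply: le_trans mK; rewrite /l /=.
have -> : 2 * r * (2 * r) = 4 * r ^+ 2 by ring.
by rewrite -ler_pdivlMr ?mulr_gt0 ?exprn_gt0// ge_min lexx orbT.
Qed.
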